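(* Let $F$ and $G$ be experiments on the state space $\Theta=\{\theta_0,\ldots,\theta_n\}$. Then $F\succeq_{\textup{LB}}G$ if and only if $W_F(\mathcal{E})\ge W_G(\mathcal{E})$ for every screening environment $\mathcal{E}$.
   Context: $\Theta=\{\theta_0,\ldots,\theta_n\}\subset\mathbb{R}$. An experiment $F$ specifies, for each $\theta$, an absolutely continuous distribution $F(\cdot\mid\theta)$ with density $f(\cdot\mid\theta)$ of a signal in a compact interval $\mathcal{X}$; likewise $G$ on a compact interval $\mathcal{Y}$. $\widehat{\Delta}_n=\{\boldsymbol{q}\in[0,1]^n:\sum_iq_i\le1\}$, a vector $\boldsymbol{p}\in\widehat{\Delta}_n$ representing the distribution on $\Theta$ with mass $p_i$ on $\theta_i$ ($i\ge1$) and $p_0=1-\sum_ip_i$ on $\theta_0$. LB order: with $p_{F,i}(x;\boldsymbol{q})=q_if(x\mid\theta_i)/\sum_jq_jf(x\mid\theta_j)$ and $\boldsymbol{p}_F(\boldsymbol{q})=(p_{F,1},\ldots,p_{F,n})(X;\boldsymbol{q})$, $X\sim\sum_jq_jF(\cdot\mid\theta_j)$, $F\succeq_{\textup{LB}}G$ means $\mathbb{E}[C(\boldsymbol{b}\cdot\boldsymbol{p}_F(\boldsymbol{q}))]\ge\mathbb{E}[C(\boldsymbol{b}\cdot\boldsymbol{p}_G(\boldsymbol{q}))]$ for all $\boldsymbol{q}\in\widehat{\Delta}_n$, $\boldsymbol{b}\in\mathbb{R}^n$ and convex $C:\mathbb{R}\to\mathbb{R}$. A screening environment $\mathcal{E}=\{\mathcal{A},\boldsymbol{q},\mathcal{P},\pi,\psi,v_1,v_2,u_1,\boldsymbol{m}\}$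 consists of a finite set of alternatives $\mathcal{A}=\{a_0,\ldots,a_k\}$; a common prior $\boldsymbol{q}\in\widehat{\Delta}_n$; a finite set of agent types $\mathcal{P}\subset\widehat{\Delta}_n$ with distribution $\pi\in\Delta(\mathcal{P})$ satisfying $\mathbb{E}_\pi[\boldsymbol{P}]=\boldsymbol{q}$ (type $\boldsymbol{p}$ is the agent's belief about $\theta$); $\psi:\mathcal{A}\to[0,1]$; $v_1,u_1:\mathcal{A}\times\Theta\to\mathbb{R}$; $v_2:\mathbb{R}\to\mathbb{R}$ continuous and convex; and $\boldsymbol{m}=(\underline{m},\overline{m})$ with $\underline{m}<\overline{m}$. Timing: the agent learns his type $\boldsymbol{p}$ (drawn from $\pi$; given $\boldsymbol{p}$, $\theta$ is distributed according to $\boldsymbol{p}$), reports a type $\boldsymbol{p}'\in\mathcal{P}$, an alternative $a$ is drawn from $\hat{a}(\boldsymbol{p}')$; then with probability $\psi(a)$ a signal $x\sim F(\cdot\mid\theta)$ is publicly observed, and with probability $1-\psi(a)$ the uninformative signal $\perp$ is observed; let $\overline{\mathcal{X}}=\mathcal{X}\cup\{\perp\}$. Then the transfer $t=\hat{t}(\boldsymbol{p}',a,x)$ is paid to the agent. A mechanism consists of an allocation rule $\hat{a}:\mathcal{P}\to\Delta(\mathcal{A})$ and a Borel-measurable transfer rule $\hat{t}:\mathcal{P}\times\mathcal{A}\times\overline{\mathcal{X}}\to[\underline{m},\overline{m}]$ (the set of such $\hat{t}$ is $\mathcal{T}^{\boldsymbol{m}}_F$). Payoffs: principal $v_1(a,\theta)-v_2(t)$,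 agent $u_1(a,\theta)+t$. Let $U(\boldsymbol{p},\boldsymbol{p}')=\mathbb{E}[u_1(a,\theta)+\hat{t}(\boldsymbol{p}',a,x)]$, expectation over $\theta\sim\boldsymbol{p}$, $a\sim\hat{a}(\boldsymbol{p}')$ and the signal as described. Then $W_F(\mathcal{E})=\sup_{\hat{a},\,\hat{t}\in\mathcal{T}^{\boldsymbol{m}}_F}\mathbb{E}[v_1(a,\theta)-v_2(\hat{t}(\boldsymbol{P},a,x))]$ (expectation over $\boldsymbol{P}\sim\pi$, $\theta\sim\boldsymbol{P}$, $a\sim\hat{a}(\boldsymbol{P})$, and the signal), subject to (IR) $U(\boldsymbol{p},\boldsymbol{p})\ge0$ for all $\boldsymbol{p}\in\mathcal{P}$ and (IC) $U(\boldsymbol{p},\boldsymbol{p})\ge U(\boldsymbol{p},\boldsymbol{p}')$ for all $\boldsymbol{p},\boldsymbol{p}'\in\mathcal{P}$. $W_G(\mathcal{E})$ is defined analogously with $G$ generating the signal on $\mathcal{Y}$. *)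

(* Defs.v *)
From HB Require Import structures.
From mathcomp Require Import all_boot all_order all_algebra.
From mathcomp Require Import all_classical all_reals.
From mathcomp Require Import ereal topology normedtype convex measure lebesgue_measure lebesgue_integral.
Set Implicit Arguments. Unset Strict Implicit. Unset Printing Implicit Defensive.
Import Order.TTheory GRing.Theory Num.Theory.
Import numFieldNormedType.Exports.
Local Open Scope classical_set_scope.
Local Open Scope ring_scope.

Section Defs.
Variables (R : realType) (n : nat).

(* The state space Theta = {theta_0,...,theta_n} is indexed by 'I_n.+1;
   theta_i corresponds to the index i. *)

Definition in_hatDelta (q : 'I_n -> R) : Prop :=
  (forall i, 0 <= q i <= 1) /\ \sum_(i < n) q i <= 1.

(* the full distribution on Theta: mass 1 - sum q_i on theta_0,
   mass q_i on theta_i (i >= 1) *)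
Definition full (q : 'I_n -> R) (i : 'I_n.+1) : R :=
  match unlift ord0 i with
  | None => 1 - \sum_(j < n) q j
  | Some j => q j
  end.

Record experiment := Experiment {
  ex_lo : R;
  ex_hi : R;
  ex_dens : 'I_n.+1 -> R -> R;
  ex_lo_le_hi : ex_lo <= ex_hi;
  ex_dens_meas : forall i, measurable_fun `[ex_lo, ex_hi] (ex_dens i);
  ex_dens_ge0 : forall i x, ex_lo <= x <= ex_hi -> 0 <= ex_dens i x;
  ex_dens_int1 : forall i,
    (\int[lebesgue_measure]_(x in `[ex_lo, ex_hi]) (ex_dens i x)%:E = 1)%E
}.

Definition sigX (F : experiment) : set R := `[ex_lo F, ex_hi F].

Definition mix_dens (F : experiment) (q : 'I_n -> R) (x : R) : R :=
  \sum_(j < n.+1) full q j * ex_dens F j x.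

Definition post (F : experiment) (q : 'I_n -> R) (i : 'I_n) (x : R) : R :=
  q i * ex_dens F (lift ord0 i) x / mix_dens F q x.

Definition LB_value (F : experiment) (q : 'I_n -> R) (b : 'I_n -> R)
    (C : R -> R) : \bar R :=
  (\int[lebesgue_measure]_(x in sigX F)
     (C (\sum_(i < n) b i * post F q i x) * mix_dens F q x)%:E)%E.

Definition convexR (C : R -> R) : Prop :=
  convex_function (E := R^o) [set: R^o] C.

Definition LB_ge (F G : experiment) : Prop :=
  forall (q : 'I_n -> R), in_hatDelta q ->
  forall (b : 'I_n -> R) (C : R -> R), convexR C ->
    (LB_value G q b C <= LB_value F q b C)%E.

(* A screening environment. Alternatives a_0..a_k are indexed by 'I_k.+1,
   the (distinct) agent types by 'I_m via the injective map en_P. *)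
Record screening_env := ScreeningEnv {
  en_k : nat;
  en_q : 'I_n -> R;
  en_m : nat;
  en_P : 'I_en_m -> ('I_n -> R);
  en_pi : 'I_en_m -> R;
  en_psi : 'I_en_k.+1 -> R;
  en_v1 : 'I_en_k.+1 -> 'I_n.+1 -> R;
  en_v2 : R -> R;
  en_u1 : 'I_en_k.+1 -> 'I_n.+1 -> R;
  en_mlo : R;
  en_mhi : R;
  en_q_in : in_hatDelta en_q;
  en_P_in : forall j, in_hatDelta (en_P j);
  en_P_inj : injective en_P;
  en_pi_ge0 : forall j, 0 <= en_pi j;
  en_pi_sum1 : \sum_(j < en_m) en_pi j = 1;
  en_mean : forall i, \sum_(j < en_m) en_pi j * en_P j i = en_q i;
  en_psi01 : forall a, 0 <= en_psi a <= 1;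
  en_v2_cont : continuous en_v2;
  en_v2_convex : convexR en_v2;
  en_m_lt : en_mlo < en_mhi
}.
Arguments en_P : clear implicits.
Arguments en_pi : clear implicits.
Arguments en_psi : clear implicits.
Arguments en_v1 : clear implicits.
Arguments en_u1 : clear implicits.

Section Mechanism.
Variables (F : experiment) (E : screening_env).
Local Notation K := 'I_(en_k E).+1.
Local Notation M := 'I_(en_m E).

(* Mechanism: allocation alloc : types -> Delta(A); transfer rule split as
   tsig p' a x (signal x in X) and tbot p' a (uninformative signal _|_). *)
Definition is_alloc (alloc : M -> K -> R) : Prop :=
  forall j, (forall a, 0 <= alloc j a) /\ \sum_(a : K) alloc j a = 1.

Definition is_transfer (tsig : M -> K -> R -> R) (tbot : M -> K -> R) : Prop :=
  (forall j a, measurable_fun (sigX F) (tsig j a)) /\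
  (forall j a x, sigX F x -> en_mlo E <= tsig j a x <= en_mhi E) /\
  (forall j a, en_mlo E <= tbot j a <= en_mhi E).

Definition cexp (g : R -> R) (i : 'I_n.+1) : R :=
  \int[lebesgue_measure]_(x in sigX F) (g x * ex_dens F i x).

Definition agentU (alloc : M -> K -> R) (tsig : M -> K -> R -> R)
    (tbot : M -> K -> R) (j j' : M) : R :=
  \sum_(a : K) alloc j' a *
    (\sum_(i < n.+1) full (en_P E j) i *
        (en_u1 E a i + en_psi E a * cexp (tsig j' a) i)
     + (1 - en_psi E a) * tbot j' a).

Definition principalV (alloc : M -> K -> R) (tsig : M -> K -> R -> R)
    (tbot : M -> K -> R) : R :=
  \sum_(j : M) en_pi E j * \sum_(a : K) alloc j a *
    (\sum_(i < n.+1) full (en_P E j) i *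
        (en_v1 E a i - en_psi E a * cexp (fun x => en_v2 E (tsig j a x)) i)
     - (1 - en_psi E a) * en_v2 E (tbot j a)).

Definition feasible (alloc : M -> K -> R) (tsig : M -> K -> R -> R)
    (tbot : M -> K -> R) : Prop :=
  is_alloc alloc /\ is_transfer tsig tbot /\
  (forall j, 0 <= agentU alloc tsig tbot j j) /\
  (forall j j', agentU alloc tsig tbot j j' <= agentU alloc tsig tbot j j).

(* W_F(E) (supremum in the extended reals; -oo if no feasible mechanism) *)
Definition W : \bar R :=
  ereal_sup [set w : \bar R | exists alloc tsig tbot,
     feasible alloc tsig tbot /\ w = (principalV alloc tsig tbot)%:E].
End Mechanism.
End Defs.

(* Main.v *)
Require Import Defs.
From mathcomp Require Import all_boot all_order all_algebra.
From mathcomp Require Import all_classical all_reals.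
From mathcomp Require Import ereal topology normedtype convex measure lebesgue_measure lebesgue_integral.
From mathcomp Require Import sequences exp measurable_realfun ring lra.
Set Implicit Arguments. Unset Strict Implicit. Unset Printing Implicit Defensive.
Import Order.TTheory GRing.Theory Num.Theory.
Import numFieldNormedType.Exports.
Local Open Scope classical_set_scope.
Local Open Scope ring_scope.

(** Both sides are equivalent to inclusion of the zonoid of [G] (the moment
    vectors [(int phi g_i)_i] of the tests [phi : Y -> [0,1]]) in the zonoid of
    [F], i.e. to the inequality [int (sum_i c_i g_i)^+ <= int (sum_i c_i f_i)^+]
    between support functions for every [c] in [R^(n+1)].

    LB order: up to the factor [mix_dens], [(b.p - s)^+] is the positive part of
    a linear combination of the densities, and every combination arises this way
    (take a uniform prior); a convex function is approximated by combinations of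
    such hinges.

    Zonoids to welfare: a transfer is the average of its layers, which are tests;
    replacing each layer by an [F]-test with the same moments leaves all payoffs
    of the agent unchanged, and by convexity the expected cost [v_2] does not
    increase (bathtub principle).  This needs moments to be matched exactly,
    hence that zonoids are closed.

    Welfare to zonoids: if [c] separates a moment vector [m] of [G] from the
    zonoid of [F], write [c = al p_1 - be p_2] with beliefs [p_1], [p_2]
    proportional to the positive and negative parts of [c].  With two types
    [p_1], [p_2] and ex-post utilities [-m_i] plus transfer on the monitored
    alternative, separating the types needs a transfer with
    [p_1.(t - m) >= 0 >= p_2.(t - m)], which [G] has and [F] has not. *)

(** * Tests and their moments *)

Section moments.
Context d (T : measurableType d) (R : realType).
Variables (mu : {measure set T -> \bar R}) (D : set T).
Hypothesis mD : measurable D.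

Lemma Rintegral_sum (I : Type) (s : seq I) (P : pred I) (h : I -> T -> R) :
  (forall i, P i -> mu.-integrable D (EFin \o h i)) ->
  mu.-integrable D (EFin \o (fun x => \sum_(i <- s | P i) h i x)) /\
  \int[mu]_(x in D) (\sum_(i <- s | P i) h i x) =
  \sum_(i <- s | P i) \int[mu]_(x in D) h i x.
Proof.
move=> ih; elim: s => [|i s [IHi IHe]].
  split; last first.
    under eq_Rintegral do rewrite big_nil.
    by rewrite big_nil Rintegral_cst// mul0r.
  apply: (@eq_integrable _ _ _ _ _ mD (cst 0%E)); last exact: integrable0.
  by move=> x _ /=; rewrite big_nil.
case: (boolP (P i)) => Pi; last first.
  have E x : \sum_(j <- i :: s | P j) h j x = \sum_(j <- s | P j) h j x.
    by rewrite big_cons (negbTE Pi).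
  rewrite (_ : (fun x => _) = (fun x => \sum_(j <- s | P j) h j x)); last exact/funext.
  by rewrite big_cons (negbTE Pi).
rewrite (_ : (fun x => _) = (fun x => h i x + \sum_(j <- s | P j) h j x)); last first.
  by apply/funext => x; rewrite big_cons Pi.
split; last by rewrite RintegralD ?big_cons ?Pi ?IHe//; exact: ih.
exact: (integrableD mD (ih _ Pi) IHi).
Qed.

Lemma integrable_scale (k : R) (g : T -> R) : mu.-integrable D (EFin \o g) ->
  mu.-integrable D (EFin \o (fun x => k * g x)).
Proof.
move=> ig; apply: (@eq_integrable _ _ _ _ _ mD (fun x => (k%:E * (EFin \o g) x)%E)).
  by move=> x _ /=; rewrite EFinM.
exact: integrableZl.
Qed.

Definition test (phi : T -> R) : Prop :=
  measurable_fun D phi /\ forall x, D x -> 0 <= phi x <= 1.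

Lemma integrableM_bounded (phi f : T -> R) (K : R) :
  measurable_fun D phi -> (forall x, D x -> `|phi x| <= K) ->
  mu.-integrable D (EFin \o f) ->
  mu.-integrable D (EFin \o (fun x => phi x * f x)).
Proof.
move=> mphi phiK intf.
have iKf := integrable_scale K intf.
apply: (le_integrable mD _ _ iKf).
  apply/measurable_EFinP; apply: measurable_funM => //.
  by apply/measurable_EFinP; case/integrableP: intf.
move=> x Dx /=; rewrite lee_fin !normrM ler_wpM2r//.
exact: le_trans (phiK x Dx) (ler_norm _).
Qed.

Lemma test_integrable (phi f : T -> R) : test phi ->
  mu.-integrable D (EFin \o f) ->
  mu.-integrable D (EFin \o (fun x => phi x * f x)).
Proof.
case=> mphi phi01; apply: (integrableM_bounded mphi (K := 1)) => x Dx.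
by have /andP[p0 p1] := phi01 x Dx; rewrite ger0_norm.
Qed.

Lemma test_convex (a : R) (phi psi : T -> R) : 0 <= a <= 1 ->
  test phi -> test psi -> test (fun x => (1 - a) * phi x + a * psi x).
Proof.
move=> /andP[a0 a1] [mphi p01] [mpsi q01]; split.
  apply: measurable_funD; apply: measurable_funM => //; exact: measurable_cst.
move=> x Dx; move: (p01 x Dx) (q01 x Dx) => /andP[? ?] /andP[? ?].
by apply/andP; split; nra.
Qed.

Lemma Rintegral_convex (a : R) (phi psi f : T -> R) : test phi -> test psi ->
  mu.-integrable D (EFin \o f) ->
  \int[mu]_(x in D) (((1 - a) * phi x + a * psi x) * f x) =
  (1 - a) * \int[mu]_(x in D) (phi x * f x) +
  a * \int[mu]_(x in D) (psi x * f x).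
Proof.
move=> tphi tpsi intf.
have i1 := test_integrable tphi intf; have i2 := test_integrable tpsi intf.
rewrite -!RintegralZl// -RintegralD//; [|exact: integrable_scale|exact: integrable_scale].
by apply: eq_Rintegral => x _; rewrite mulrDl !mulrA.
Qed.

Lemma test_moment_dist (phi psi f : T -> R) : test phi -> test psi ->
  mu.-integrable D (EFin \o f) ->
  `|\int[mu]_(x in D) (phi x * f x) - \int[mu]_(x in D) (psi x * f x)| <=
  \int[mu]_(x in D) `|f x|.
Proof.
move=> tphi tpsi intf.
have i1 := test_integrable tphi intf; have i2 := test_integrable tpsi intf.
rewrite -RintegralB//; apply: le_trans (le_normr_Rintegral _ _) _ => //.
  exact: (integrableB mD i1 i2).
apply: le_Rintegral => //.
- exact: (integrable_norm (integrableB mD i1 i2)).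
- exact: integrable_norm.
move=> x Dx; rewrite -mulrBl normrM ler_piMl//.
case: tphi tpsi => _ /(_ x Dx) /andP[? ?] [_ /(_ x Dx) /andP[? ?]].
by rewrite ler_norml; apply/andP; split; lra.
Qed.

End moments.

(** * Almost everywhere convergence of sequences with summable steps *)

Lemma cvgn_of_bounded_variation (R : realType) (u : R^nat) (S : R) :
  (forall n, \sum_(0 <= k < n) `|u k.+1 - u k| <= S) -> cvgn u.
Proof.
move=> uS; have ct : cvgn (series (telescope u)).
  apply: normed_cvg; apply: nondecreasing_is_cvgn.
    by apply: nondecreasing_series => n _ _; exact: normr_ge0.
  by exists S => _ [n _ <-]; exact: uS.
rewrite (_ : u = (fun n => u 0%N + series (telescope u) n)); last first.
  by apply/funext => n; exact: eq_sum_telescope.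
exact: is_cvgD (is_cvg_cst _) ct.
Qed.

(** The sum of the absolute steps has integral at most [C * 2], so it is finite almost everywhere;
    at such a point the sequence has bounded variation. *)
Lemma summable_steps_cvg d (T : measurableType d) (R : realType)
    (mu : {measure set T -> \bar R}) (D : set T) (mD : measurable D)
    (psi : nat -> T -> R) (C : R) :
  (forall k, measurable_fun D (psi k)) ->
  (forall k, mu.-integrable D (EFin \o (fun x => psi k.+1 x - psi k x))) ->
  (forall k, \int[mu]_(x in D) `|psi k.+1 x - psi k x| <= C * 2^-1 ^+ k) ->
  {ae mu, forall x, D x -> cvgn (psi ^~ x)}.
Proof.
move=> mpsi ipsi psiC.
have C0 : 0 <= C.
  by move: (psiC 0%N); rewrite expr0 mulr1; apply: le_trans; exact: Rintegral_ge0.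
pose h k x : \bar R := (`|psi k.+1 x - psi k x|)%:E.
have mh k : measurable_fun D (h k).
  by apply/measurable_EFinP; apply: measurableT_comp => //; exact: measurable_funB.
have h0 k x : D x -> (0 <= h k x)%E by rewrite lee_fin.
have hE k : (\int[mu]_(x in D) h k x <= (C * 2^-1 ^+ k)%:E)%E.
  have := integrable_norm (ipsi k) => /integrable_fin_num => /(_ mD) hf.
  by rewrite -(fineK hf) lee_fin; exact: psiC.
have sC n : (\sum_(0 <= k < n) (C * 2^-1 ^+ k)%:E <= (C * 2)%:E)%E.
  rewrite sumEFin lee_fin.
  suff -> : \sum_(0 <= i < n) C * 2^-1 ^+ i = C * 2 - C * 2 * 2^-1 ^+ n :> R.
    by rewrite gerBl// mulr_ge0// ?mulr_ge0// exprn_ge0.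
  elim: n => [|n IH]; first by rewrite big_geq// expr0 mulr1 subrr.
  by rewrite big_nat_recr//= IH exprS; field.
have intS : mu.-integrable D (fun x => \sum_(k <oo) h k x)%E.
  apply/integrableP; split.
    have := @ge0_emeasurable_sum _ _ _ D h xpredT; apply => // k x Dx _; exact: h0.
  rewrite (eq_integral (fun x => \sum_(k <oo) h k x)%E); last first.
    by move=> x /set_mem Dx; rewrite gee0_abs// nneseries_ge0// => k _ _; exact: h0.
  rewrite integral_nneseries//.
  apply: (@le_lt_trans _ _ (C * 2)%:E); last by rewrite ltry.
  apply: lime_le.
    by apply: is_cvg_nneseries => k _ _; exact: integral_ge0 (h0 k).
  by apply: nearW => n; apply: le_trans (sC n); apply: lee_sum => k _.
apply: filterS (integrable_ae mD intS) => x + Dx => /(_ Dx) fS.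
apply: (@cvgn_of_bounded_variation _ _ (fine (\sum_(k <oo) h k x))%E) => n.
rewrite -lee_fin fineK// -sumEFin.
by apply: (nneseries_lim_ge (P := xpredT)) => k _ _; exact: h0.
Qed.

(** * Near-minimizers of the L2 norm and closedness of the moment set *)

Section zonoid.
Context d (T : measurableType d) (R : realType).
Variables (mu : {measure set T -> \bar R}) (D : set T).
Hypotheses (mD : measurable D) (muD : (mu D < +oo)%E).

Lemma integrable_cst (k : R) : mu.-integrable D (EFin \o (fun=> k)).
Proof.
apply: measurable_bounded_integrable => //.
by exists `|k|; split; [exact: num_real|move=> x xk y _ /=; exact: ltW].
Qed.

Lemma test_integrable1 (phi : T -> R) :
  test D phi -> mu.-integrable D (EFin \o phi).
Proof.
move=> tphi; apply: (@eq_integrable _ _ _ _ _ mD (EFin \o (fun x => phi x * 1))).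
  by move=> x _ /=; rewrite mulr1.
exact: test_integrable (integrable_cst 1).
Qed.

Lemma integrable_lin (a b : R) (g h : T -> R) :
  mu.-integrable D (EFin \o g) -> mu.-integrable D (EFin \o h) ->
  mu.-integrable D (EFin \o (fun x => a * g x + b * h x)) /\
  \int[mu]_(x in D) (a * g x + b * h x) =
  a * \int[mu]_(x in D) g x + b * \int[mu]_(x in D) h x.
Proof.
move=> ig ih.
split; first exact: (integrableD mD (integrable_scale mD a ig) (integrable_scale mD b ih)).
by rewrite RintegralD ?RintegralZl//; exact: integrable_scale.
Qed.

(** By the parallelogram identity the bracket is half the squared L2 distance of the tests, so
    near-minimizers of the L2 norm are close in L1; [s] balances the two terms. *)
Lemma test_distance (phi psi : T -> R) (s : R) : test D phi -> test D psi -> 0 < s ->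
  \int[mu]_(x in D) `|phi x - psi x| <=
  s^-1 * (\int[mu]_(x in D) (phi x * phi x) + \int[mu]_(x in D) (psi x * psi x) -
    2 * \int[mu]_(x in D) (((1 - 2^-1) * phi x + 2^-1 * psi x) *
                           ((1 - 2^-1) * phi x + 2^-1 * psi x))) +
  s * (fine (mu D) / 2).
Proof.
move=> tphi tpsi s0.
have h01 : 0 <= (2^-1 : R) <= 1 by apply/andP; split; lra.
have tchi := test_convex h01 tphi tpsi.
set chi := fun x => _ in tchi.
have sq u : test D u -> mu.-integrable D (EFin \o (fun x => u x * u x)).
  by move=> tu; exact: test_integrable (test_integrable1 tu).
have [i1 e1] := integrable_lin 1 1 (sq _ tphi) (sq _ tpsi).
have [i2 e2] := integrable_lin 1 (- 2) i1 (sq _ tchi).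
have [i3 e3] := integrable_lin s^-1 s i2 (integrable_cst 2^-1).
rewrite [leRHS](_ : _ = s^-1 * (1 * (1 * \int[mu]_(x in D) (phi x * phi x)
   + 1 * \int[mu]_(x in D) (psi x * psi x)) + - 2 *
   \int[mu]_(x in D) (chi x * chi x)) + s * (2^-1 * fine (mu D))); last first.
  by rewrite [2^-1 * _]mulrC !mul1r mulNr.
rewrite -Rintegral_cst// -e1 -e2 -e3; apply: le_Rintegral => //.
  by apply: integrable_norm; exact: integrableB (test_integrable1 _) (test_integrable1 _).
move=> x Dx; rewrite /chi.
set a := phi x; set b := psi x.
(* AM-GM: [2 |a - b| <= (a - b)^2 / s + s] *)
have -> : s^-1 * (1 * (1 * (a * a) + 1 * (b * b)) + -2 *
   (((1 - 2^-1) * a + 2^-1 * b) * ((1 - 2^-1) * a + 2^-1 * b))) + s * 2^-1 =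
   `|a - b| + s^-1 * 2^-1 * (`|a - b| - s) ^+ 2.
  have -> : (`|a - b| - s) ^+ 2 = (a - b) ^+ 2 - 2 * s * `|a - b| + s ^+ 2.
    by rewrite -[(a - b) ^+ 2]real_normK ?num_real//; ring.
  by field; rewrite gt_eqF.
by rewrite lerDl mulr_ge0 ?sqr_ge0// mulr_ge0// invr_ge0 ltW.
Qed.

(* The tests with moments [e]-close to [m] form a decreasing family of convex
   sets; near-minimizers of the L2 norm in them are Cauchy by the
   parallelogram identity. *)
Lemma moment_set_closed N (f : 'I_N -> T -> R) (m : 'I_N -> R) :
  (forall i, mu.-integrable D (EFin \o f i)) ->
  (forall e : R, 0 < e -> exists2 phi, test D phi &
     forall i, `|\int[mu]_(x in D) (phi x * f i x) - m i| <= e) ->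
  exists2 phi, test D phi & forall i, \int[mu]_(x in D) (phi x * f i x) = m i.
Proof.
move=> intf approx.
pose q (phi : T -> R) := \int[mu]_(x in D) (phi x * phi x).
pose A (e : R) (phi : T -> R) := test D phi /\
  forall i, `|\int[mu]_(x in D) (phi x * f i x) - m i| <= e.
have A_le e e' phi : e <= e' -> A e phi -> A e' phi.
  by move=> ee' [tphi Aphi]; split => // i; exact: le_trans ee'.
have A_mid e phi psi : A e phi -> A e psi ->
    A e (fun x => (1 - 2^-1) * phi x + 2^-1 * psi x).
  move=> [tphi Aphi] [tpsi Apsi].
  have h01 : 0 <= (2^-1 : R) <= 1 by apply/andP; split; lra.
  split=> [|i]; first exact: test_convex.
  rewrite Rintegral_convex//.
  move: (Aphi i) (Apsi i); rewrite !ler_norml => /andP[? ?] /andP[? ?].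
  by apply/andP; split; lra.
have q_ge0 phi : 0 <= q phi.
  by apply: Rintegral_ge0 => x _; rewrite -expr2 sqr_ge0.
have q_le phi : test D phi -> q phi <= fine (mu D).
  move=> tphi; rewrite -[leRHS]mul1r -Rintegral_cst//; apply: le_Rintegral => //.
  - exact: test_integrable (test_integrable1 tphi).
  - exact: integrable_cst.
  - by move=> x Dx; case: tphi => _ /(_ x Dx) /andP[? ?]; nra.
(* [dd e] does not decrease as [e] shrinks, so [sup S] below is its limit at 0. *)
pose dd (e : R) := inf (q @` A e).
have dd_inf e : 0 < e -> has_inf (q @` A e).
  move=> e0; split; last by exists 0 => _ [phi _ <-].
  by have [phi tphi mphi] := approx e e0; exists (q phi), phi.
have dd_lb e phi : 0 < e -> A e phi -> dd e <= q phi.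
  by move=> e0 Aphi; apply: ge_inf; [exact: (dd_inf e e0).2|exists phi].
pose S := dd @` [set e | 0 < e].
have S_sup : has_sup S.
  split; first by exists (dd 1), 1 => //=.
  exists (fine (mu D)) => _ [e /= e0 <-].
  have [phi tphi mphi] := approx e e0.
  exact: le_trans (dd_lb e phi e0 (conj tphi mphi)) (q_le _ tphi).
have near_min (eta : R) : 0 < eta -> exists p : R * (T -> R),
    [/\ 0 < p.1 <= eta, A p.1 p.2, q p.2 <= sup S + eta &
        forall chi, A p.1 chi -> sup S - eta <= q chi].
  move=> eta0; have [_ [e0 /= e0_gt0 <-] e0S] := sup_adherent eta0 S_sup.
  have me0 : 0 < Num.min e0 eta by rewrite lt_min e0_gt0.
  have [_ [psi Apsi <-] psiE] := inf_adherent eta0 (dd_inf _ me0).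
  exists (Num.min e0 eta, psi); split => //=.
  - by rewrite me0 ge_min lexx orbT.
  - apply/ltW/(lt_le_trans psiE); rewrite lerD2r.
    by apply: ub_le_sup; [exact: S_sup.2|exists (Num.min e0 eta)].
  - move=> chi Achi; apply/ltW/(lt_le_trans e0S); apply: dd_lb => //.
    by apply: A_le Achi; rewrite ge_min lexx.
(* The tolerances are [s k ^+ 2] because [test_distance] divides the error in [q] by its parameter
   [s k]; the L1 steps are then of order [s k], hence summable. *)
pose s (k : nat) : R := 2^-1 ^+ k.
have s_gt0 k : 0 < s k by rewrite exprn_gt0.
have [p pP] := @choice _ _ (fun k (p : R * (T -> R)) =>
    [/\ 0 < p.1 <= s k ^+ 2, A p.1 p.2, q p.2 <= sup S + s k ^+ 2 &
        forall chi, A p.1 chi -> sup S - s k ^+ 2 <= q chi])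
  (fun k => near_min (s k ^+ 2) (exprn_gt0 2 (s_gt0 k))).
pose psi k := (p k).2.
have tpsi k : test D (psi k) by have [_ []] := pP k.
have s_anti k : s k.+1 ^+ 2 <= s k ^+ 2.
  have := s_gt0 k; have -> : s k.+1 = 2^-1 * s k by rewrite /s exprS.
  by rewrite !expr2; nra.
have step k : \int[mu]_(x in D) `|psi k.+1 x - psi k x| <=
    (4 + fine (mu D) / 2) * 2^-1 ^+ k.
  apply: le_trans (test_distance (tpsi k.+1) (tpsi k) (s_gt0 k)) _.
  have [/andP[? ?] Ak qk lk] := pP k; have [/andP[? ?] Ak1 qk1 lk1] := pP k.+1.
  set chi := (X in 2 * X).
  (* The midpoint lies in the set with the larger of the two tolerances, whose lower bound on [q]
     applies. *)
  have chi_ge : sup S - s k ^+ 2 <= chi.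
    have [le|lt] := leP (p k).1 (p k.+1).1.
      apply: le_trans (lk1 _ (A_mid _ _ _ Ak1 (A_le _ _ _ le Ak))).
      by rewrite lerD2l lerN2.
    by apply: lk; apply: A_mid => //; exact: A_le (ltW lt) _.
  rewrite [leRHS]mulrDl; apply: lerD; last by rewrite mulrC.
  rewrite -/(s k) mulrC ler_pdivrMr// -mulrA -expr2.
  have : q (psi k.+1) <= sup S + s k ^+ 2 by apply: le_trans qk1 _; rewrite lerD2l.
  by move: qk; rewrite /q /psi; lra.
have cvpsi := summable_steps_cvg mD (fun k => (tpsi k).1)
  (fun k => integrableB mD (test_integrable1 (tpsi k.+1)) (test_integrable1 (tpsi k)))
  step.
(* Clipping the upper limit gives values in [0,1] also where the sequence diverges. *)
pose phi x := Num.max 0 (Num.min 1 (limn_sup (psi ^~ x))).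
have psi01 k x : D x -> 0 <= psi k x <= 1 by case: (tpsi k) => _; apply.
have mphi : measurable_fun D phi.
  apply: measurable_maxr; first exact: measurable_cst.
  apply: measurable_minr; first exact: measurable_cst.
  apply: measurable_fun_limn_sup => [x Dx|x Dx|k]; last exact: (tpsi k).1.
    by exists 1 => _ [k _ <-]; have /andP[] := psi01 k x Dx.
  by exists 0 => _ [k _ <-]; have /andP[] := psi01 k x Dx.
have tphi : test D phi.
  split => // x Dx; rewrite /phi le_max lexx/= ge_max ler01 ge_min lexx.
  by [].
exists phi => // i.
have cvphi : {ae mu, forall x, D x -> psi ^~ x @ \oo --> phi x}.
  apply: filterS cvpsi => x + Dx => /(_ Dx) cx.
  have l0 : 0 <= limn (psi ^~ x).
    by apply: limr_ge => //; apply: nearW => k; have /andP[] := psi01 k x Dx.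
  have l1 : limn (psi ^~ x) <= 1.
    by apply: limr_le => //; apply: nearW => k; have /andP[] := psi01 k x Dx.
  by rewrite /phi cvg_limn_supE// (min_idPr l1) (max_idPr l0).
have mf : measurable_fun D (f i).
  by apply/measurable_EFinP; case/integrableP: (intf i).
have cv : (\int[mu]_(x in D) (psi k x * f i x)%:E)%E @[k --> \oo] -->
    (\int[mu]_(x in D) (phi x * f i x)%:E)%E.
  case: (@dominated_convergence _ _ _ mu D mD (fun k x => (psi k x * f i x)%:E)
    (fun x => (phi x * f i x)%:E) (fun x => `|f i x|%:E)) => [|||||_ _ //].
  - by move=> k; apply/measurable_EFinP; exact: measurable_funM (tpsi k).1 mf.
  - by apply/measurable_EFinP; exact: measurable_funM.
  - apply: filterS cvphi => x + Dx => /(_ Dx) cx.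
    by apply: cvg_EFin; [exact: nearW|exact: cvgMr_tmp].
  - exact: integrable_norm (intf i).
  - apply: aeW => x k Dx /=; rewrite lee_fin normrM ler_piMl//.
    by have /andP[? ?] := psi01 k x Dx; rewrite ger0_norm.
have {}cv : \int[mu]_(x in D) (psi k x * f i x) @[k --> \oo] -->
    \int[mu]_(x in D) (phi x * f i x).
  by apply: fine_cvg; rewrite fineK// integrable_fin_num//; exact: test_integrable.
have cvm : \int[mu]_(x in D) (psi k x * f i x) @[k --> \oo] --> m i.
  apply/subr_cvg0/norm_cvg0P.
  apply: (@squeeze_cvgr _ _ _ _ (fun=> 0) s); last 2 first.
  - exact: cvg_cst.
  - by apply: cvg_expr; rewrite ger0_norm; lra.
  apply: nearW => k; rewrite normr_ge0/=.
  have [/andP[_ pk] [_ /(_ i) Ak] _ _] := pP k.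
  apply: le_trans Ak (le_trans pk _).
  rewrite expr2 ler_piMl ?(ltW (s_gt0 k))//.
  by rewrite /s exprn_ile1//; lra.
exact: (cvg_unique _ cv cvm).
Qed.
End zonoid.

(** * Support functions and membership in the zonoid *)

Section support.
Context d (T : measurableType d) (R : realType).
Variables (mu : {measure set T -> \bar R}) (D : set T).
Hypotheses (mD : measurable D) (muD : (mu D < +oo)%E).
Variables (N : nat) (f : 'I_N -> T -> R).
Hypothesis intf : forall i, mu.-integrable D (EFin \o f i).

(** This is the support function of the set of moment vectors: a test weighs the combination by
    values in [0,1], at best selecting its positive part. *)
Definition support_function (c : 'I_N -> R) : R :=
  \int[mu]_(x in D) Num.max (\sum_i c i * f i x) 0.

Lemma integrable_comb (c : 'I_N -> R) :
  mu.-integrable D (EFin \o (fun x => \sum_i c i * f i x)).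
Proof.
apply: (Rintegral_sum mD _ _).1 => i _.
exact: integrable_scale.
Qed.

Lemma integrable_pos_part (g : T -> R) : mu.-integrable D (EFin \o g) ->
  mu.-integrable D (EFin \o (fun x => Num.max (g x) 0)).
Proof.
move=> ig; apply: (le_integrable mD _ _ (integrable_norm ig)).
  apply/measurable_EFinP; apply: measurable_maxr; last exact: measurable_cst.
  by apply/measurable_EFinP; case/integrableP: ig.
move=> x Dx /=; rewrite lee_fin normr_id.
by case: (ltP (g x) 0) => h; rewrite ?normr0.
Qed.

Lemma Rintegral_comb (c : 'I_N -> R) (phi : T -> R) :
  (forall i, mu.-integrable D (EFin \o (fun x => phi x * f i x))) ->
  \int[mu]_(x in D) (phi x * \sum_i c i * f i x) =
  \sum_i c i * \int[mu]_(x in D) (phi x * f i x).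
Proof.
move=> i1; under eq_Rintegral do rewrite mulr_sumr.
have i2 i : mu.-integrable D (EFin \o (fun x => phi x * (c i * f i x))).
  rewrite (_ : (fun x => _) = (fun x => c i * (phi x * f i x))).
    exact: integrable_scale.
  by apply/funext => x; exact: mulrCA.
rewrite (Rintegral_sum mD _ _).2//; apply: eq_bigr => i _.
rewrite -RintegralZl//; apply: eq_Rintegral => x _; exact: mulrCA.
Qed.

Lemma test_le_support (c : 'I_N -> R) (phi : T -> R) : test D phi ->
  \sum_i c i * \int[mu]_(x in D) (phi x * f i x) <= support_function c.
Proof.
move=> tphi; rewrite -Rintegral_comb; last by move=> i; exact: test_integrable.
apply: le_Rintegral => //.
- exact: test_integrable (integrable_comb c).
- exact: integrable_pos_part (integrable_comb c).
move=> x Dx; have [_ /(_ x Dx)/andP[? ?]] := tphi.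
by rewrite le_max; case: (lerP 0 (\sum_i c i * f i x)) => ?; apply/orP; [left|right]; nra.
Qed.

(** The optimal test is the indicator of the set where the combination is positive, as in the
    Neyman-Pearson lemma. *)
Lemma support_attained (c : 'I_N -> R) : exists2 phi, test D phi &
  \sum_i c i * \int[mu]_(x in D) (phi x * f i x) = support_function c.
Proof.
pose S x := \sum_i c i * f i x.
pose phi x : R := if 0 < S x then 1 else 0.
have mS : measurable_fun D S.
  by apply/measurable_EFinP; case/integrableP: (integrable_comb c).
have tphi : test D phi.
  split; last by move=> x _; rewrite /phi; case: ifP; rewrite ?lexx ?ler01.
  apply: measurable_fun_if => //; first exact: measurable_fun_ltr.
exists phi => //; rewrite -Rintegral_comb; last by move=> i; exact: test_integrable.
apply: eq_Rintegral => x _.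
rewrite /phi /S; case: ltP => h; first by rewrite mul1r.
by rewrite mul0r.
Qed.

(* If no test came close to [m], moving from a near-closest moment vector
   towards the one exposed by the direction of [m] would come closer. *)
Lemma zonoid_mem (m : 'I_N -> R) :
  (forall c, \sum_i c i * m i <= support_function c) ->
  exists2 phi, test D phi & forall i, \int[mu]_(x in D) (phi x * f i x) = m i.
Proof.
move=> msupp; apply: moment_set_closed => //.
pose M (phi : T -> R) i := \int[mu]_(x in D) (phi x * f i x).
pose Q phi := \sum_i (M phi i - m i) ^+ 2.
pose E := Q @` test D.
have t0 : test D (fun=> 0 : R).
  by split; [exact: measurable_cst|move=> x _; rewrite lexx ler01].
have infE : has_inf E.
  split; first by exists (Q (fun=> 0)), (fun=> 0).
  by exists 0 => _ [phi _ <-]; apply: sumr_ge0 => i _; exact: sqr_ge0.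
have lbE phi : test D phi -> inf E <= Q phi.
  by move=> tphi; apply: ge_inf; [exact: infE.2|exists phi].
have inf0 : inf E <= 0.
  rewrite leNgt; apply/negP => E0.
  (* [K] bounds the squared distance between any two moment vectors; the step size [t] solves
     [t * K = (1 - t) * inf E]. *)
  pose K := \sum_i (\int[mu]_(x in D) `|f i x|) ^+ 2.
  have K0 : 0 <= K by apply: sumr_ge0 => i _; exact: sqr_ge0.
  pose t := inf E / (inf E + K).
  have EK : 0 < inf E + K by rewrite ltr_wpDr.
  have t_gt0 : 0 < t by rewrite divr_gt0.
  have t_le1 : t <= 1 by rewrite ler_pdivrMr// mul1r lerDl.
  have tK : t * K = inf E - t * inf E by rewrite /t; field; rewrite gt_eqF.
  have [_ [phi tphi <-]] := inf_adherent (mulr_gt0 t_gt0 E0) infE.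
  (* [psi] is extreme in the direction from the moments of [phi] to [m]. Moving a fraction [t]
     towards it brings [Q] below [(1 - t ^+ 2) * inf E], a contradiction. *)
  have [psi tpsi psiE] := support_attained (fun i => m i - M phi i).
  have tt : test D (fun x => (1 - t) * phi x + t * psi x).
    by apply: test_convex => //; rewrite ltW.
  have := lbE _ tt.
  have -> : Q (fun x => (1 - t) * phi x + t * psi x) =
      Q phi - 2 * t * (\sum_i (m i - M phi i) * (M psi i - M phi i)) +
      t ^+ 2 * \sum_i (M psi i - M phi i) ^+ 2.
    rewrite /Q !mulr_sumr -sumrB -big_split/=; apply: eq_bigr => i _.
    by rewrite {1}/M Rintegral_convex// -/(M phi i) -/(M psi i); ring.
  have : \sum_i (M psi i - M phi i) ^+ 2 <= K.
    apply: ler_sum => i _; rewrite -[leLHS]real_normK ?num_real//.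
    by rewrite lerXn2r ?nnegrE ?normr_ge0 ?Rintegral_ge0//; exact: test_moment_dist.
  have : Q phi <= \sum_i (m i - M phi i) * (M psi i - M phi i).
    rewrite (_ : \sum_i _ * _ = \sum_i (m i - M phi i) * M psi i -
       \sum_i (m i - M phi i) * m i + Q phi).
      by rewrite lerDr subr_ge0 psiE; exact: msupp.
    rewrite /Q -sumrB -big_split/=; apply: eq_bigr => i _; ring.
  move: (lbE _ tphi).
  set A := \sum_i _; set B := \sum_i _; move=> h1 h2 h3 h4 h5.
  have h6 : t * inf E <= t * A by rewrite ler_pM2l//; lra.
  have h7 : t ^+ 2 * B <= t * (t * K) by rewrite mulrA -expr2 ler_wpM2l ?sqr_ge0.
  have h8 : t * (t * K) <= t * K by rewrite ler_piMl// mulr_ge0// ltW.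
  nra.
move=> e e0; have [_ [phi tphi <-] Qe] := inf_adherent (exprn_gt0 2 e0) infE.
exists phi => // i.
suff : (M phi i - m i) ^+ 2 <= e ^+ 2.
  by rewrite -[leLHS]real_normK ?num_real// ler_sqr ?nnegrE// ltW.
apply: (@le_trans _ _ (Q phi)); last by rewrite ltW//; lra.
by rewrite /Q (bigD1 i)//= lerDl; apply: sumr_ge0 => j _; exact: sqr_ge0.
Qed.
End support.

(** * Convex functions on the line *)

Section convex.
Variable R : realType.
Implicit Types (C v w : R -> R).

Lemma convexRP C : convexR C <-> forall t x y, 0 <= t <= 1 ->
  C (t * x + (1 - t) * y) <= t * C x + (1 - t) * C y.
Proof.
split=> [hC t x y /andP[t0 t1]|hC t x y _ _].
  by have := hC (Itv01 t0 t1) x y; rewrite !in_setT; apply.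
by apply: hC; rewrite ge0 le1.
Qed.

Lemma convexR_affine C (a b : R) : convexR C -> convexR (fun x => C (a + b * x)).
Proof.
move=> /convexRP hC; apply/convexRP => t x y t01.
rewrite (_ : a + _ = t * (a + b * x) + (1 - t) * (a + b * y)); first exact: hC.
by ring.
Qed.

(** Both [a + h] and [b] lie between [a] and [b + h], with mirrored weights; add the two convexity
    inequalities. *)
Lemma convexR_increment C (a b h : R) : convexR C -> a <= b -> 0 <= h ->
  C (a + h) - C a <= C (b + h) - C b.
Proof.
move=> /convexRP hC; rewrite le_eqVlt => /predU1P[-> //|ab h0].
have L0 : 0 < b + h - a by lra.
have l01 : 0 <= h / (b + h - a) <= 1.
  by apply/andP; split; [exact: divr_ge0 h0 (ltW L0)|rewrite ler_pdivrMr//; lra].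
have := hC _ a (b + h) l01; have := hC _ (b + h) a l01.
rewrite (_ : _ * (b + h) + _ = a + h); last by field; rewrite gt_eqF.
rewrite (_ : _ * a + _ = b); last by field; rewrite gt_eqF.
by lra.
Qed.

(** An increment inside [a, b] lies between those of the same length ending at [a] and starting at
    [b], which chord slopes over the length [H] control. *)
Lemma convexR_lipschitz C (a b : R) : convexR C -> a <= b -> exists2 L, 0 <= L &
  forall x y, a <= x -> x <= y -> y <= b -> `|C y - C x| <= L * (y - x).
Proof.
(* [H] exceeds every step inside [a, b] and is positive even when [a = b]. *)
move=> hC ab; pose H := b - a + 1.
have H0 : 0 < H by rewrite /H; lra.
pose L := `|C (b + H) - C b| / H + `|C (a - H) - C a| / H.
have E1 : 0 <= `|C (b + H) - C b| / H by rewrite divr_ge0// ltW.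
have E2 : 0 <= `|C (a - H) - C a| / H by rewrite divr_ge0// ltW.
exists L; first exact: addr_ge0.
move=> x y ax xy yb; pose h := y - x; have h0 : 0 <= h by rewrite subr_ge0.
have hH : 0 <= h / H <= 1.
  apply/andP; split; first exact: divr_ge0 h0 (ltW H0).
  by rewrite ler_pdivrMr// mul1r /h /H; lra.
have yE : y = x + h by rewrite /h; ring.
have up := convexR_increment hC (le_trans xy yb) h0.
have lo := @convexR_increment C (a - h) x h hC _ h0.
rewrite -yE in up lo; rewrite subrK in lo.
have {}lo := lo (ltac:(lra)).
move/convexRP: hC => hC.
have := hC _ (b + H) b hH; have := hC _ (a - H) a hH.
rewrite (_ : _ * (b + H) + _ = b + h); last by field; rewrite gt_eqF.
rewrite (_ : _ * (a - H) + _ = a - h); last by field; rewrite gt_eqF.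
have -> : h / H * C (a - H) + (1 - h / H) * C a = C a + h * ((C (a - H) - C a) / H).
  by field; rewrite gt_eqF.
have -> : h / H * C (b + H) + (1 - h / H) * C b = C b + h * ((C (b + H) - C b) / H).
  by field; rewrite gt_eqF.
have U1 : h * ((C (b + H) - C b) / H) <= h * (`|C (b + H) - C b| / H).
  by rewrite ler_wpM2l// ler_wpM2r ?ler_norm// invr_ge0 ltW.
have U2 : h * ((C (a - H) - C a) / H) <= h * (`|C (a - H) - C a| / H).
  by rewrite ler_wpM2l// ler_wpM2r ?ler_norm// invr_ge0 ltW.
have U3 := mulr_ge0 h0 E1; have U4 := mulr_ge0 h0 E2.
rewrite -/h [L * h]mulrC /L mulrDr ler_norml => c1 c2.
by apply/andP; split; lra.
Qed.

Lemma convexR_continuous C : convexR C -> continuous C.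
Proof.
move=> hC x.
have [L L0 hL] := @convexR_lipschitz C (x - 1) (x + 1) hC ltac:(lra).
apply/cvgrPdist_le => e e0.
exists (Num.min 1 (e / (L + 1))) => /=.
  by rewrite lt_min ltr01 divr_gt0//; lra.
move=> y /=; rewrite lt_min => /andP[d1 d2].
have d3 : L * `|x - y| <= e.
  have : `|x - y| * (L + 1) < e by rewrite -ltr_pdivlMr//; lra.
  by have := normr_ge0 (x - y); nra.
have [xy|/ltW yx] := leP x y.
  move: d1 d3; rewrite !(distrC x) (ger0_norm (x := y - x)) ?subr_ge0// => d1 d3.
  by rewrite distrC; apply: le_trans (hL _ _ _ _ _) d3; lra.
move: d1 d3; rewrite (ger0_norm (x := x - y)) ?subr_ge0// => d1 d3.
by apply: le_trans (hL _ _ _ _ _) d3; lra.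
Qed.

(* Among the weights [psi] with a given sum, the increments of a convex
   function weigh least when the first ones are filled up first. *)
Lemma convexR_bathtub w N (psi : nat -> R) : convexR w ->
  (forall k, (k < N)%N -> 0 <= psi k <= 1) ->
  w (\sum_(k < N) psi k) <= w 0 + \sum_(k < N) (w k.+1%:R - w k%:R) * psi k.
Proof.
move=> hw; elim: N => [|N IH] psi01; first by rewrite !big_ord0 addr0.
rewrite !big_ord_recr/=.
have {}IH := IH (fun k kN => psi01 k (ltnW kN)).
set s := \sum_(i < N) psi i in IH *.
have sN : s <= N%:R.
  rewrite -[leRHS]mulr1n -[N in leRHS]card_ord -sumr_const.
  by apply: ler_sum => i _; have /andP[] := psi01 i (ltnW (ltn_ord i)).
(* The last weight takes a fraction of the unit increment at [s], which is at most the one at [N]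
   because [s <= N]. *)
have inc := convexR_increment hw sN ler01.
have p01 := psi01 N (ltnSn N); have /andP[p0 p1] := p01.
have /convexRP/(_ (psi N) (s + 1) s p01) := hw.
rewrite (_ : psi N * (s + 1) + _ = s + psi N); last by ring.
rewrite -natr1; move: IH inc; set S := \sum_(i < N) _; move=> IH inc H.
have : psi N * (w (s + 1) - w s) <= psi N * (w (N%:R + 1) - w N%:R).
  by rewrite ler_wpM2l.
by nra.
Qed.

(** This is [tau - k] clipped to [0,1]; as a difference of two hinges its mean is a difference of
    support functions in the LB argument. *)
Definition layer (tau : R) (k : nat) : R :=
  Num.max (tau - k%:R) 0 - Num.max (tau - k.+1%:R) 0.

Lemma layer01 tau k : 0 <= layer tau k <= 1.
Proof.
rewrite /layer -natr1.
by case: (leP (tau - k%:R) 0); case: (leP (tau - (k%:R + 1)) 0) => *;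
  apply/andP; split; lra.
Qed.

Lemma layer_low tau k : tau <= k%:R -> layer tau k = 0.
Proof.
move=> h; rewrite /layer -natr1.
by case: (leP (tau - k%:R) 0); case: (leP (tau - (k%:R + 1)) 0) => *; lra.
Qed.

Lemma layer_high tau k : k.+1%:R <= tau -> layer tau k = 1.
Proof.
rewrite /layer -natr1 => h.
by case: (leP (tau - k%:R) 0); case: (leP (tau - (k%:R + 1)) 0) => *; lra.
Qed.

Lemma sum_layer tau N : 0 <= tau <= N%:R -> \sum_(k < N) layer tau k = tau.
Proof.
move=> /andP[t0 tN]; rewrite -(big_mkord xpredT (layer tau)).
rewrite /layer (eq_bigr (fun k => - (Num.max (tau - k.+1%:R) 0 - Num.max (tau - k%:R) 0))); last first.
  by move=> k _; rewrite opprB.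
rewrite sumrN telescope_sumr// subr0 (max_idPl t0) (max_idPr _) ?subr_le0//.
by rewrite sub0r opprK.
Qed.

(** The left side is the piecewise linear interpolant of [w] at the integers: an average of its
    values at two nodes around [tau], both at distance at most 1. *)
Lemma interpolation_le w N (e tau : R) :
  (forall x y, 0 <= x -> x <= y -> y <= N%:R -> y - x <= 1 -> `|w y - w x| <= e) ->
  0 <= tau <= N%:R ->
  w 0 + \sum_(k < N) (w k.+1%:R - w k%:R) * layer tau k <= w tau + e.
Proof.
elim: N => [|N IH] we /andP[t0 tN].
  rewrite big_ord0 addr0.
  have -> : tau = 0 by apply/eqP; rewrite eq_le t0 tN.
  by rewrite lerDl; have := we 0 0; rewrite !subrr normr0; apply.
rewrite big_ord_recr/=; have [le|gt] := leP tau N%:R.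
  rewrite (layer_low le) mulr0 addr0; apply: IH; last by rewrite t0.
  move=> x y x0 xy yN; apply: we => //; apply: le_trans yN _.
  by rewrite ler_nat.
rewrite (_ : \sum_(k < N) _ = w N%:R - w 0); last first.
  transitivity (\sum_(k < N) (w k.+1%:R - w k%:R)).
    apply: eq_bigr => k _; rewrite layer_high ?mulr1//.
    by apply: le_trans (ltW gt); rewrite ler_nat.
  by rewrite -(big_mkord xpredT (fun k => w k.+1%:R - w k%:R)) telescope_sumr.
have l01 := layer01 tau N; set l := layer tau N in l01 *.
move: tN gt; rewrite -natr1 => tN gt.
have := we N%:R tau (ler0n _ _) (ltW gt).
rewrite -natr1 => /(_ tN ltac:(lra)); rewrite ler_norml => /andP[h1 h2].
have := we tau N.+1%:R t0; rewrite -natr1 => /(_ tN (lexx _) ltac:(lra)).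
rewrite ler_norml => /andP[h3 h4].
by nra.
Qed.

(** With a Lipschitz constant [L] of [v], a mesh fine enough that [L * (M - m) <= e * N] keeps the
    oscillation of [v] on each cell below [e]. *)
Lemma convexR_interpolation v (m M e : R) : convexR v -> m <= M -> 0 < e ->
  exists2 N, (0 < N)%N & forall tau, 0 <= tau <= N%:R ->
    let w x := v (m + (M - m) / N%:R * x) in
    w 0 + \sum_(k < N) (w k.+1%:R - w k%:R) * layer tau k <= w tau + e.
Proof.
move=> hv mM e0; have [L L0 hL] := convexR_lipschitz hv mM.
have [n nE] : exists n : nat, L * (M - m) / e <= n%:R.
  by exists (Num.truncn (L * (M - m) / e)).+1; apply/ltW/truncnS_gt.
exists n.+1 => // tau tauN.
apply: (@interpolation_le (fun x => v (m + (M - m) / n.+1%:R * x))) => // x y x0 xy yN d1.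
have N0 : 0 < n.+1%:R :> R by rewrite ltr0n.
have d0 : 0 <= (M - m) / n.+1%:R by rewrite divr_ge0 ?subr_ge0// ltW.
apply: le_trans (hL _ _ _ _ _) _.
- by rewrite lerDl mulr_ge0.
- by rewrite lerD2l ler_wpM2l.
- apply: (@le_trans _ _ (m + (M - m) / n.+1%:R * n.+1%:R)).
    by rewrite lerD2l ler_wpM2l.
  by rewrite divfK ?gt_eqF//; lra.
have E : L * (M - m) <= e * n.+1%:R.
  move: nE; rewrite ler_pdivrMr// => /le_trans; apply.
  by rewrite mulrC ler_pM2l// ler_nat.
have -> : L * (m + (M - m) / n.+1%:R * y - (m + (M - m) / n.+1%:R * x)) =
  L * (M - m) / n.+1%:R * (y - x) by ring.
have {}E : L * (M - m) / n.+1%:R <= e by rewrite ler_pdivrMr.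
apply: le_trans E; rewrite ler_piMr//.
by rewrite -mulrA mulr_ge0.
Qed.

End convex.

(** * Experiments *)

Section experiments.
Variables (R : realType) (n : nat).
Implicit Types (F G : experiment R n) (q b : 'I_n -> R) (c : 'I_n.+1 -> R).
Local Notation lambda := (@lebesgue_measure R).

Lemma measurable_sigX F : (measurable : set (set (measurableTypeR R))) (sigX F).
Proof. exact: measurable_itv. Qed.
Local Hint Resolve measurable_sigX : core.

Lemma finite_sigX F : (lambda (sigX F) < +oo)%E.
Proof. by rewrite /sigX lebesgue_measure_itv; case: ifP => _; rewrite ?ltry. Qed.
Local Hint Resolve finite_sigX : core.

Lemma dens_ge0 F i x : sigX F x -> 0 <= ex_dens F i x.
Proof. by rewrite /sigX/= in_itv/=; exact: ex_dens_ge0. Qed.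

Lemma integrable_dens F i : lambda.-integrable (sigX F) (EFin \o ex_dens F i).
Proof.
apply/integrableP; split; first by apply/measurable_EFinP; exact: ex_dens_meas.
under eq_integral => x /set_mem xF do rewrite /= ger0_norm ?dens_ge0//.
by rewrite ex_dens_int1 ltry.
Qed.
Local Hint Resolve integrable_dens : core.

Lemma Rintegral_dens F i : \int[lambda]_(x in sigX F) ex_dens F i x = 1.
Proof. by rewrite /Rintegral ex_dens_int1. Qed.

Definition bounded_meas F (g : R -> R) : Prop :=
  measurable_fun (sigX F) g /\ exists K, forall x, sigX F x -> `|g x| <= K.

Lemma bounded_meas_integrable F g i : bounded_meas F g ->
  lambda.-integrable (sigX F) (EFin \o (fun x => g x * ex_dens F i x)).
Proof.
move=> [mg [K gK]].
exact: (integrableM_bounded (mu := lambda) (measurable_sigX F) mg gK (integrable_dens F i)).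
Qed.

Lemma bounded_meas_itv F g (m M : R) : measurable_fun (sigX F) g ->
  (forall x, sigX F x -> m <= g x <= M) -> bounded_meas F g.
Proof.
move=> mg gmM; split=> //; exists (`|m| + `|M|) => x /gmM /andP[gm gM].
have := ler_norm M; have := ler_norm (- m); rewrite normrN => ? ?.
have := normr_ge0 M; have := normr_ge0 m => ? ?.
by rewrite ler_norml; apply/andP; split; lra.
Qed.

Lemma test_bounded_meas F phi : test (sigX F) phi -> bounded_meas F phi.
Proof. by case=> mphi; exact: bounded_meas_itv. Qed.

Lemma cexp_le F g h i : bounded_meas F g -> bounded_meas F h ->
  (forall x, sigX F x -> g x <= h x) -> cexp F g i <= cexp F h i.
Proof.
move=> bg bh gh; apply: le_Rintegral => //; try exact: bounded_meas_integrable.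
by move=> x xF; apply: ler_wpM2r; [exact: dens_ge0|exact: gh].
Qed.

Lemma eq_cexp F g h i : (forall x, sigX F x -> g x = h x) ->
  cexp F g i = cexp F h i.
Proof. by move=> gh; apply: eq_Rintegral => x /set_mem /gh ->. Qed.

Lemma cexp_affine F N (a : R) (b : 'I_N -> R) (g : 'I_N -> R -> R) i :
  (forall k, bounded_meas F (g k)) ->
  bounded_meas F (fun x => a + \sum_k b k * g k x) /\
  cexp F (fun x => a + \sum_k b k * g k x) i = a + \sum_k b k * cexp F (g k) i.
Proof.
move=> bg; split.
  split.
    apply: measurable_funD; first exact: measurable_cst.
    apply: measurable_sum => k; apply: measurable_funM; first exact: measurable_cst.
    by case: (bg k).
  have [K gK] := choice (fun k => (bg k).2).
  exists (`|a| + \sum_k `|b k| * K k) => x xF.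
  apply: le_trans (ler_normD _ _) _; rewrite lerD2l.
  apply: le_trans (ler_norm_sum _ _ _) _; apply: ler_sum => k _.
  by rewrite normrM ler_wpM2l// gK.
have ib k : lambda.-integrable (sigX F)
    (EFin \o (fun x => b k * (g k x * ex_dens F i x))).
  by apply: integrable_scale => //; exact: bounded_meas_integrable.
have ia : lambda.-integrable (sigX F) (EFin \o (fun x => a * ex_dens F i x)).
  exact: integrable_scale.
have [is_ es] := @Rintegral_sum _ _ _ lambda _ (measurable_sigX F) _
  (index_enum 'I_N) xpredT _ (fun k _ => ib k).
rewrite /cexp; transitivity (\int[lambda]_(x in sigX F) (a * ex_dens F i x +
    \sum_k b k * (g k x * ex_dens F i x))).
  apply: eq_Rintegral => x _; rewrite mulrDl mulr_suml; congr (_ + _).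
  by apply: eq_bigr => k _; rewrite mulrA.
rewrite RintegralD// RintegralZl// Rintegral_dens mulr1 es; congr (_ + _).
by apply: eq_bigr => k _; rewrite RintegralZl//; exact: bounded_meas_integrable.
Qed.

Lemma cexpDr F g (e : R) i : bounded_meas F g ->
  cexp F (fun x => g x + e) i = cexp F g i + e.
Proof.
move=> bg; have [_] := @cexp_affine F 1 e (fun=> 1) (fun=> g) i (fun=> bg).
rewrite big_ord1 mul1r [RHS]addrC => <-; apply: eq_cexp => x _.
by rewrite big_ord1 mul1r addrC.
Qed.

(** * Zonoid inclusion and welfare *)

Definition supp F c : R := support_function lambda (sigX F) (ex_dens F) c.

(** Inclusion of the zonoid of [G] in that of [F], expressed by support functions; closedness turns
    it into exact matching of moments. *)
Definition zonoid_le G F : Prop := forall c, supp G c <= supp F c.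

Lemma zonoid_le_test F G phi : zonoid_le G F -> test (sigX G) phi ->
  exists2 psi, test (sigX F) psi & forall i, cexp F psi i = cexp G phi i.
Proof.
move=> GF tphi; apply: (zonoid_mem (measurable_sigX F) (finite_sigX F) (integrable_dens F)) => c.
apply: le_trans (GF c).
exact: (test_le_support (measurable_sigX G) (integrable_dens G)).
Qed.

(* A transfer is the average of its layers [layer tau k]; replacing each layer
   by a test with the same moments keeps the moments and, by the bathtub
   principle, does not increase the convex cost. *)
Lemma zonoid_le_transfer F G (v t : R -> R) (m M e : R) :
  zonoid_le G F -> convexR v -> m < M -> 0 < e ->
  measurable_fun (sigX G) t -> (forall y, sigX G y -> m <= t y <= M) ->
  exists s, [/\ measurable_fun (sigX F) s, forall x, sigX F x -> m <= s x <= M,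
    forall i, cexp F s i = cexp G t i &
    forall i, cexp F (fun x => v (s x)) i <= cexp G (fun y => v (t y)) i + e].
Proof.
move=> GF hv mM e0 mt tmM.
have [N N0 interp] := convexR_interpolation hv (ltW mM) e0.
have N_gt0 : 0 < N%:R :> R by rewrite ltr0n.
pose dl := (M - m) / N%:R; have dl0 : 0 < dl by rewrite divr_gt0// subr_gt0.
have dlN : dl * N%:R = M - m by rewrite /dl divfK// gt_eqF.
pose tau y := (t y - m) / dl.
have tauK y : m + dl * tau y = t y by rewrite /tau; field; rewrite gt_eqF.
have tau01 y : sigX G y -> 0 <= tau y <= N%:R.
  move=> /tmM /andP[h1 h2]; rewrite /tau ler_pdivrMr// [_ * dl]mulrC dlN.
  by apply/andP; split; [apply: divr_ge0; [lra|exact: ltW]|lra].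
have mtau : measurable_fun (sigX G) tau.
  by apply: measurable_funM => //; apply: measurable_funB.
pose phi k y := layer (tau y) k.
have tphi k : test (sigX G) (phi k).
  split; last by move=> y _; exact: layer01.
  by apply: measurable_funB; apply: measurable_maxr => //; exact: measurable_funB.
have [psi psiP] := @choice _ _ (fun k psi => test (sigX F) psi /\
  forall i, cexp F psi i = cexp G (phi k) i)
  (fun k => let: ex_intro2 psi tpsi e := zonoid_le_test GF (tphi k) in
            ex_intro _ psi (conj tpsi e)).
have bpsi k : bounded_meas F (psi k) by apply: test_bounded_meas; have [] := psiP k.
have bphi k : bounded_meas G (phi k) by exact: test_bounded_meas.
pose s x := m + \sum_(k < N) dl * psi k x.
have sE x : s x = m + dl * \sum_(k < N) psi k x by rewrite /s mulr_sumr.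
have tE y : sigX G y -> t y = m + \sum_(k < N) dl * phi k y.
  by move=> yG; rewrite -mulr_sumr sum_layer ?tauK//; exact: tau01.
have bs : bounded_meas F s.
  by have [] := @cexp_affine F N m (fun=> dl) psi ord0 bpsi.
have smM x : sigX F x -> m <= s x <= M.
  move=> xF; rewrite sE.
  have p01 (k : 'I_N) : 0 <= psi k x <= 1 by have [[_ +] _] := psiP k; exact.
  have p0 : 0 <= \sum_(k < N) psi k x.
    by apply: sumr_ge0 => k _; have /andP[] := p01 k.
  have p1 : \sum_(k < N) psi k x <= N%:R.
    rewrite -[leRHS]mulr1n -[N in leRHS]card_ord -sumr_const.
    by apply: ler_sum => k _; have /andP[] := p01 k.
  rewrite lerDl mulr_ge0 ?(ltW dl0)//=.
  have : dl * \sum_(k < N) psi k x <= dl * N%:R by rewrite ler_wpM2l// ltW.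
  by rewrite dlN; lra.
exists s; split => //; first by case: bs.
  move=> i; rewrite (eq_cexp i tE) /s.
  rewrite (@cexp_affine F N m (fun=> dl) psi i bpsi).2.
  rewrite (@cexp_affine G N m (fun=> dl) phi i bphi).2.
  by congr (_ + _); apply: eq_bigr => k _; rewrite (psiP k).2.
move=> i; pose w x := v (m + dl * x).
have hw : convexR w by exact: convexR_affine.
have bv H g : measurable_fun (sigX H) g -> (forall x, sigX H x -> m <= g x <= M) ->
    bounded_meas H (fun x => v (g x)).
  move=> mg gmM; split.
    apply: (measurableT_comp _ mg); apply: continuous_measurable_fun.
    exact: convexR_continuous.
  have [L L0 hL] := convexR_lipschitz hv (ltW mM).
  exists (`|v m| + L * (M - m)) => x /gmM /andP[g1 g2].
  have := hL m (g x) (lexx _) g1 g2.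
  have : L * (g x - m) <= L * (M - m) by rewrite ler_wpM2l// lerD2r.
  have := ler_normD (v m) (v (g x) - v m); rewrite addrC subrK; lra.
pose b (k : 'I_N) := w k.+1%:R - w k%:R.
have [bF eF] := @cexp_affine F N (w 0) b psi i bpsi.
have [bG eG] := @cexp_affine G N (w 0) b phi i bphi.
(* Three comparisons: the bathtub bound for the tests [psi k], which need not be layers of a common
   transfer; equality of moments with [phi k]; the interpolation error [e] for the true layers
   [phi k]. *)
apply: (@le_trans _ _ (cexp F (fun x => w 0 + \sum_(k < N) b k * psi k x) i)).
  apply: cexp_le => //; first by apply: bv => //; case: bs.
  move=> x xF; rewrite sE; apply: (convexR_bathtub (psi := fun k => psi k x)) => // k _.
  by have [[_ +] _] := psiP k; exact.
rewrite eF (_ : \sum_k _ = \sum_k b k * cexp G (phi k) i); last first.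
  by apply: eq_bigr => k _; rewrite (psiP k).2.
rewrite -eG -cexpDr; last exact: bv.
apply: cexp_le => //.
  have [mv [K vK]] := bv _ _ mt tmM; split; first exact: measurable_funD.
  exists (K + `|e|) => y yG; apply: le_trans (ler_normD _ _) _.
  by rewrite lerD2r; exact: vK.
by move=> y yG; rewrite -[in leRHS]tauK; exact: interp (tau01 y yG).
Qed.

Lemma full_ge0 q i : in_hatDelta q -> 0 <= full q i.
Proof.
move=> [q01 qs]; rewrite /full; case: unliftP => [j _|_]; last by rewrite subr_ge0.
by have /andP[] := q01 j.
Qed.

Lemma full_lift q j : full q (lift ord0 j) = q j.
Proof. by rewrite /full liftK. Qed.

Lemma sum_full q : \sum_i full q i = 1.
Proof.
rewrite big_ord_recl [full q ord0]/full unlift_none.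
by rewrite [X in _ + X](eq_bigr q) ?subrK// => j _; exact: full_lift.
Qed.

(** Only the transfers after an informative signal are replaced. The agent's payoffs see them
    through their moments, so (IR) and (IC) carry over, while the expected cost rises by at most an
    arbitrary [e]. *)
Lemma zonoid_le_W F G (E : screening_env R n) : zonoid_le G F -> (W G E <= W F E)%E.
Proof.
move=> GF; apply: ge_ereal_sup => _ [alloc [t [tb [[al [[mt [tmM tbmM]] [ir ic]]] ->]]]].
apply/lee_addgt0Pr => e e0.
have [s sP] := @choice ('I_(en_m E) * 'I_(en_k E).+1) (R -> R) _
  (fun p => zonoid_le_transfer GF (en_v2_convex E) (en_m_lt E) e0
              (mt p.1 p.2) (tmM p.1 p.2)).
pose ts j a := s (j, a).
have tsE j a i : cexp F (ts j a) i = cexp G (t j a) i by have [_ _ ->] := sP (j, a).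
have UE j j' : agentU F alloc ts tb j j' = agentU G alloc t tb j j'.
  apply: eq_bigr => a _; congr (_ * (_ + _)); apply: eq_bigr => i _.
  by rewrite tsE.
have fea : feasible F alloc ts tb.
  split=> //; split; last by split=> [j|j j']; rewrite !UE.
  split=> [j a|]; first by have [] := sP (j, a).
  by split=> // j a x xF; have [_ + _ _] := sP (j, a); exact.
apply: (@le_trans _ _ ((principalV F alloc ts tb)%:E + e%:E)%E); last first.
  by rewrite leeD2r//; apply: ereal_sup_ubound; exists alloc, ts, tb.
(* The weights over types, alternatives and states each sum to 1, so [e] is distributed over them
   and the values are compared term by term. *)
rewrite -EFinD lee_fin -[e]mulr1 -(en_pi_sum1 E) mulr_sumr /principalV -big_split/=.
apply: ler_sum => j _; rewrite [e * _]mulrC -mulrDr ler_wpM2l ?en_pi_ge0//.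
have [al0 al1] := al j.
rewrite -[e]mulr1 -{}al1 mulr_sumr -big_split/=.
apply: ler_sum => a _; rewrite [e * _]mulrC -mulrDr ler_wpM2l//.
rewrite addrAC lerD2r.
rewrite -[e in leRHS]mulr1 -(sum_full (en_P j)) mulr_sumr -big_split/=.
apply: ler_sum => i _; rewrite [e * _]mulrC -mulrDr ler_wpM2l ?full_ge0//.
  exact: en_P_in.
have [_ _ _ /(_ i) vle] := sP (j, a).
have /andP[ps0 ps1] := en_psi01 a.
rewrite -addrA lerD2l /ts; move: vle.
set A := cexp F _ i; set B := cexp G _ i => vle.
by nra.
Qed.
End experiments.

(** * The LB order *)

Section lb_order.
Variables (R : realType) (n : nat).
Implicit Types (F G : experiment R n) (q b : 'I_n -> R) (c : 'I_n.+1 -> R).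
Local Notation lambda := (@lebesgue_measure R).

Lemma mix_ge0 F q x : in_hatDelta q -> sigX F x -> 0 <= mix_dens F q x.
Proof.
move=> hq xF; apply: sumr_ge0 => j _.
by rewrite mulr_ge0 ?full_ge0 ?dens_ge0.
Qed.

(** Where the mixture density vanishes, each of its nonnegative summands does too, so both sides are
    0 whatever the division returns. *)
Lemma post_mix F q i x : in_hatDelta q -> sigX F x ->
  post F q i x * mix_dens F q x = q i * ex_dens F (lift ord0 i) x.
Proof.
move=> hq xF; rewrite /post; have [m0|/eqP m0] := eqVneq (mix_dens F q x) 0; last first.
  by rewrite divfK//; exact/eqP.
rewrite m0 mulr0; apply/esym/eqP.
move: m0 => /eqP; rewrite psumr_eq0; last first.
  by move=> j _; rewrite mulr_ge0 ?full_ge0 ?dens_ge0.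
by move=> /allP/(_ (lift ord0 i)); rewrite mem_index_enum full_lift; apply.
Qed.

Lemma post01 F q i x : in_hatDelta q -> sigX F x -> 0 <= post F q i x <= 1.
Proof.
move=> hq xF; have q0 : 0 <= q i by have [/(_ i)/andP[]] := hq.
have f0 := dens_ge0 (lift ord0 i) xF.
have m0 := mix_ge0 hq xF.
apply/andP; split; first by rewrite /post divr_ge0// mulr_ge0.
rewrite /post; have [->|mn0] := eqVneq (mix_dens F q x) 0; first by rewrite invr0 mulr0.
rewrite ler_pdivrMr ?mul1r; last by rewrite lt_neqAle eq_sym mn0.
rewrite /mix_dens (bigD1 (lift ord0 i))//= full_lift lerDl.
by apply: sumr_ge0 => j _; rewrite mulr_ge0 ?full_ge0 ?dens_ge0.
Qed.

Lemma measurable_mix F q : measurable_fun (sigX F) (mix_dens F q).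
Proof.
apply: measurable_sum => j; apply: measurable_funM; first exact: measurable_cst.
exact: ex_dens_meas.
Qed.

Lemma measurable_post F q i : in_hatDelta q -> measurable_fun (sigX F) (post F q i).
Proof.
move=> hq; apply: measurable_funM.
  by apply: measurable_funM; [exact: measurable_cst|exact: ex_dens_meas].
apply: (@eq_measurable_fun _ _ _ _ _ (fun x => mix_dens F q x `^ (- 1))).
  by move=> x /set_mem xF; rewrite powR_inv1// mix_ge0.
apply: (@measurableT_comp _ _ _ _ _ _ (fun y : R => y `^ (-1)) (sigX F) (mix_dens F q)).
  exact: (measurable_powR (-1)).
exact: measurable_mix.
Qed.

Lemma index_bound F q b x : in_hatDelta q -> sigX F x ->
  `|\sum_i b i * post F q i x| <= \sum_i `|b i|.
Proof.
move=> hq xF; apply: le_trans (ler_norm_sum _ _ _) _; apply: ler_sum => i _.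
by rewrite normrM; have /andP[p0 p1] := post01 i hq xF; rewrite (ger0_norm p0) ler_piMr.
Qed.

Definition mexp F q (g : R -> R) : R := \sum_j full q j * cexp F g j.

Lemma mexpE F q g : bounded_meas F g ->
  lambda.-integrable (sigX F) (EFin \o (fun x => g x * mix_dens F q x)) /\
  \int[lambda]_(x in sigX F) (g x * mix_dens F q x) = mexp F q g.
Proof.
move=> bg; split; last first.
  apply: (Rintegral_comb (measurable_sigX F)) => j.
  exact: bounded_meas_integrable.
have [mg [K gK]] := bg.
apply: (integrableM_bounded (measurable_sigX F) mg gK).
exact: (integrable_comb (measurable_sigX F) (integrable_dens F)).
Qed.

Lemma mexp_le F q g h : in_hatDelta q -> bounded_meas F g -> bounded_meas F h ->
  (forall x, sigX F x -> g x <= h x) -> mexp F q g <= mexp F q h.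
Proof.
move=> hq bg bh gh; apply: ler_sum => j _.
by rewrite ler_wpM2l ?full_ge0//; exact: cexp_le.
Qed.

Lemma mexp_affine F q N (a : R) (b : 'I_N -> R) (g : 'I_N -> R -> R) :
  (forall k, bounded_meas F (g k)) ->
  mexp F q (fun x => a + \sum_k b k * g k x) = a + \sum_k b k * mexp F q (g k).
Proof.
move=> bg; rewrite /mexp; under eq_bigr do rewrite (cexp_affine _ _ _ bg).2 mulrDr.
rewrite big_split/= -mulr_suml sum_full mul1r; congr (_ + _).
under eq_bigr do rewrite mulr_sumr; rewrite exchange_big/=.
apply: eq_bigr => k _; rewrite mulr_sumr; apply: eq_bigr => j _; exact: mulrCA.
Qed.

(** Coefficients of the index plus [s], times the mixture density, as a combination of the state
    densities; the index has no weight on theta_0, hence the default 0. *)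
Definition hinge_coef q b (s : R) (j : 'I_n.+1) : R :=
  full q j * (oapp b 0 (unlift ord0 j) + s).

Lemma index_mix F q b s x : in_hatDelta q -> sigX F x ->
  (\sum_i b i * post F q i x + s) * mix_dens F q x =
  \sum_j hinge_coef q b s j * ex_dens F j x.
Proof.
move=> hq xF; rewrite mulrDl mulr_suml.
rewrite (eq_bigr (fun i => full q (lift ord0 i) * b i * ex_dens F (lift ord0 i) x)); last first.
  by move=> i _; rewrite -mulrA post_mix// full_lift mulrCA mulrA.
rewrite [in X in s * X]/mix_dens.
rewrite mulr_sumr [in LHS]addrC big_ord_recl -addrA -big_split/= [RHS]big_ord_recl.
rewrite /hinge_coef unlift_none/= add0r; congr (_ + _); first by ring.
by apply: eq_bigr => i _; rewrite liftK/=; ring.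
Qed.

Lemma hinge_mix F q b s x : in_hatDelta q -> sigX F x ->
  Num.max (\sum_i b i * post F q i x + s) 0 * mix_dens F q x =
  Num.max (\sum_j hinge_coef q b s j * ex_dens F j x) 0.
Proof.
by move=> hq xF; rewrite maxr_pMl ?mix_ge0// mul0r index_mix.
Qed.

(** The nonnegative mixture density moves inside the positive part, which turns a hinge of the
    posterior into a support function. *)
Lemma mexp_hinge F q b s : in_hatDelta q ->
  bounded_meas F (fun x => Num.max (\sum_i b i * post F q i x + s) 0) /\
  mexp F q (fun x => Num.max (\sum_i b i * post F q i x + s) 0) =
  supp F (hinge_coef q b s).
Proof.
move=> hq.
have bm : bounded_meas F (fun x => Num.max (\sum_i b i * post F q i x + s) 0).
  split.
    apply: measurable_maxr; last exact: measurable_cst.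
    apply: measurable_funD; last exact: measurable_cst.
    apply: measurable_sum => i; apply: measurable_funM; first exact: measurable_cst.
    exact: measurable_post.
  exists (\sum_i `|b i| + `|s|) => x xF.
  apply: (@le_trans _ _ `|\sum_i b i * post F q i x + s|).
    by case: (leP (\sum_i b i * post F q i x + s) 0) => h; rewrite ?normr0.
  apply: le_trans (ler_normD _ _) _; rewrite lerD2r; exact: index_bound.
split=> //; rewrite -(mexpE q bm).2.
by apply: eq_Rintegral => x /set_mem xF; exact: hinge_mix.
Qed.

(** Under the uniform prior every state has positive mass, so [hinge_coef] can be solved for any
    [c]: the shift is read off at theta_0 and [b] from the differences to it. *)
Lemma LB_ge_zonoid_le F G : LB_ge F G -> zonoid_le G F.
Proof.
move=> lb c.
have n0 : 0 < n.+1%:R :> R by rewrite ltr0n.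
have n1 : n.+1%:R != 0 :> R by rewrite gt_eqF.
pose q := fun _ : 'I_n => n.+1%:R^-1 : R.
have sq : \sum_(i < n) q i = n%:R / n.+1%:R.
  by rewrite /q sumr_const card_ord mulr_natl.
have hq : in_hatDelta q.
  split=> [i|]; first by rewrite invr_ge0 ltW//= invf_le1// ler1n.
  by rewrite sq ler_pdivrMr// mul1r ler_nat.
have fq j : full q j = n.+1%:R^-1.
  rewrite /full; case: unliftP => [//|_]; rewrite sq.
  by rewrite -[in n%:R](addrK 1 n%:R) natr1; field; rewrite nat1r.
pose b := fun i => n.+1%:R * (c (lift ord0 i) - c ord0).
have cE : hinge_coef q b (n.+1%:R * c ord0) = c.
  apply/funext => j; rewrite /hinge_coef fq; case: unliftP => [i ->|->] /=.
    by rewrite /b -mulrDr subrK mulKf.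
  by rewrite add0r mulKf.
pose C (t : R) := Num.max (t + n.+1%:R * c ord0) 0.
have hC : convexR C.
  apply/convexRP => t x y /andP[t0 t1]; rewrite /C.
  by do 3 case: (leP _ 0) => ?; nra.
have valE H : LB_value H q b C = (supp H c)%:E.
  have [bm sE] := mexp_hinge H b (n.+1%:R * c ord0) hq.
  have [im iE] := mexpE q bm.
  rewrite cE -iE in sE; rewrite -sE /Rintegral fineK//.
  exact: (integrable_fin_num (measurable_sigX H) im).
by have := lb q hq b C hC; rewrite !valE lee_fin.
Qed.

(** Summation by parts against the nonnegative steps of [s]. The boundary term at [N] carries the
    induction and vanishes in the application. *)
Lemma abel_ge0 (s Dl : nat -> R) N :
  (forall k, s k <= s k.+1) -> (forall k, 0 <= Dl k) -> Dl 0%N = 0 ->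
  - (s N * Dl N) <= \sum_(k < N) s k * (Dl k - Dl k.+1).
Proof.
move=> s_mono D0 D00; elim: N => [|N IH]; first by rewrite D00 mulr0 oppr0 big_ord0.
rewrite big_ord_recr/=.
have : s N * Dl N.+1 <= s N.+1 * Dl N.+1 by rewrite ler_wpM2r.
by move: IH; set S := \sum_(i < N) _; lra.
Qed.

(* On the range of the index [b.p] the convex function is, up to [e], a
   combination of hinges whose integrals are values of the support functions;
   the extreme hinges are affine there and the Abel-summed coefficients of the
   other ones are nonnegative. *)
Lemma zonoid_le_LB_ge F G : zonoid_le G F -> LB_ge F G.
Proof.
move=> GF q hq b C hC.
(* The added 1 keeps the interval from [- B] to [B] nondegenerate when [b] is 0. *)
pose B := \sum_i `|b i| + 1.
have B0 : 0 < B by rewrite ltr_pwDr// sumr_ge0.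
pose ix H x := \sum_i b i * post H q i x.
have ixB H x : sigX H x -> - B <= ix H x <= B.
  move=> xH; have := index_bound b hq xH; rewrite -/(ix H x) ler_norml /B.
  by move=> /andP[? ?]; apply/andP; split; lra.
have mix_ H : measurable_fun (sigX H) (ix H).
  apply: measurable_sum => i; apply: measurable_funM; first exact: measurable_cst.
  exact: measurable_post.
have [L L0 hL] := @convexR_lipschitz _ C (- B) B hC ltac:(lra).
have bC H : bounded_meas H (fun x => C (ix H x)).
  split.
    apply: (measurableT_comp _ (mix_ H)); apply: continuous_measurable_fun.
    exact: convexR_continuous.
  exists (`|C (- B)| + L * (B - - B)) => x /(ixB H) /andP[g1 g2].
  have := hL (- B) (ix H x) (lexx _) g1 g2.
  have : L * (ix H x - - B) <= L * (B - - B) by rewrite ler_wpM2l// lerD2r.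
  have := ler_normD (C (- B)) (C (ix H x) - C (- B)); rewrite addrC subrK; lra.
have valE H : LB_value H q b C = (mexp H q (fun x => C (ix H x)))%:E.
  have [im iE] := mexpE q (bC H).
  by rewrite -iE /Rintegral fineK//; exact: (integrable_fin_num (measurable_sigX H) im).
rewrite !valE lee_fin; apply/ler_addgt0Pr => e e0.
have [N N0 interp] := @convexR_interpolation _ C (- B) B e hC ltac:(lra) e0.
have N_gt0 : 0 < N%:R :> R by rewrite ltr0n.
pose dl := (B - - B) / N%:R; have dl0 : 0 < dl by rewrite divr_gt0//; lra.
have dlN : dl * N%:R = B - - B by rewrite /dl divfK// gt_eqF.
pose tau H x := \sum_i (b i / dl) * post H q i x + B / dl.
have tauE H x : - B + dl * tau H x = ix H x.
  have -> : dl * tau H x = ix H x + B; last by rewrite addrC addrK.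
  rewrite /tau mulrDr mulr_sumr; congr (_ + _); last by rewrite mulrC divfK ?gt_eqF.
  by apply: eq_bigr => i _; field; rewrite gt_eqF.
have tau01 H x : sigX H x -> 0 <= tau H x <= N%:R.
  move=> /ixB /andP[h1 h2]; have E := tauE H x.
  rewrite -(ler_pM2l dl0) -[tau H x <= _](ler_pM2l dl0) dlN mulr0.
  by apply/andP; split; lra.
pose hg H k x := Num.max (tau H x - k%:R) 0.
have hgE H k : bounded_meas H (hg H k) /\
    mexp H q (hg H k) = supp H (hinge_coef q (fun i => b i / dl) (B / dl - k%:R)).
  have := mexp_hinge H (fun i => b i / dl) (B / dl - k%:R) hq.
  rewrite (_ : (fun x => _) = hg H k)//.
  by apply/funext => x; rewrite /hg /tau addrA.
(* On its range [tau] is nonnegative, so the hinge at 0 is [tau] itself, and its mean is the same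
   for all experiments because densities integrate to 1. *)
have D0E H : mexp H q (hg H 0%N) =
    \sum_j hinge_coef q (fun i => b i / dl) (B / dl) j.
  rewrite -(mexpE q (hgE H 0%N).1).2.
  transitivity (\int[lambda]_(x in sigX H)
      (1 * \sum_j hinge_coef q (fun i => b i / dl) (B / dl) j * ex_dens H j x)).
    apply: eq_Rintegral => x /set_mem xH; rewrite mul1r -index_mix//.
    by rewrite /hg subr0 (max_idPl _)//; have /andP[] := tau01 H x xH.
  have t1 : test (sigX H) (fun=> 1 : R).
    by split; [exact: measurable_cst|move=> x _; rewrite lexx ler01].
  rewrite (Rintegral_comb (measurable_sigX H)); last first.
    move=> j; exact: (test_integrable (measurable_sigX H) t1 (integrable_dens H j)).
  apply: eq_bigr => j _; rewrite -[RHS]mulr1; congr (_ * _).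
  rewrite -[RHS](Rintegral_dens H j); apply: eq_Rintegral => x _; exact: mul1r.
have DNE H : mexp H q (hg H N) = 0.
  rewrite -(mexpE q (hgE H N).1).2 -[RHS](mul0r (fine (lambda (sigX H)))).
  rewrite -(Rintegral_cst lambda (measurable_sigX H) 0).
  apply: eq_Rintegral => x /set_mem xH; rewrite /hg (max_idPr _) ?mul0r//.
  by rewrite subr_le0; have /andP[] := tau01 H x xH.
pose w x := C (- B + dl * x).
have hw : convexR w by exact: convexR_affine.
pose sl k := w k.+1%:R - w k%:R.
pose lay H k x := layer (tau H x) k.
have bl H k : bounded_meas H (lay H k).
  apply: bounded_meas_itv (0 : R) (1 : R) _ _; last by move=> x _; exact: layer01.
  by apply: measurable_funB; [have [[]] := hgE H k|have [[]] := hgE H k.+1].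
have layE H k : mexp H q (lay H k) = mexp H q (hg H k) - mexp H q (hg H k.+1).
  rewrite -sumrB; apply: eq_bigr => j _; rewrite -mulrBr; congr (_ * _).
  rewrite /cexp -(RintegralB (measurable_sigX H)
    (bounded_meas_integrable j (hgE H k).1) (bounded_meas_integrable j (hgE H k.+1).1)).
  by apply: eq_Rintegral => x _; rewrite -mulrBl.
pose J H := w 0 + \sum_(k < N) sl k * mexp H q (lay H k).
have bJ H : bounded_meas H (fun x => w 0 + \sum_(k < N) sl k * lay H k x).
  by have [] := @cexp_affine _ _ H N (w 0) sl (lay H) ord0 (fun k => bl H k).
have JE H : mexp H q (fun x => w 0 + \sum_(k < N) sl k * lay H k x) = J H.
  by rewrite (@mexp_affine H q N (w 0) sl (lay H) (fun k => bl H k)).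
(* Two one-sided estimates suffice: the interpolant is above [C] on the side of [G], and at most [e]
   above it on the side of [F]. *)
have upper : mexp G q (fun x => C (ix G x)) <= J G.
  rewrite -JE; apply: mexp_le => // x xG.
  rewrite -tauE -[tau G x in leLHS](sum_layer (tau01 G x xG)).
  by exact: (convexR_bathtub (psi := layer (tau G x)) hw (fun k _ => layer01 _ k)).
have lower : J F <= mexp F q (fun x => C (ix F x)) + e.
  have -> : mexp F q (fun x => C (ix F x)) + e =
      mexp F q (fun x => C (ix F x) + e).
    rewrite [RHS](eq_bigr (fun j => full q j * cexp F (fun x => C (ix F x)) j
      + full q j * e)); last by move=> j _; rewrite cexpDr// mulrDr.
    by rewrite big_split/= -mulr_suml sum_full mul1r.
  rewrite -JE; apply: mexp_le => //.
    have [mC [K CK]] := bC F; split; first exact: measurable_funD.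
    exists (K + `|e|) => x xF; apply: le_trans (ler_normD _ _) _.
    by rewrite lerD2r; exact: CK.
  by move=> x xF; rewrite -[in leRHS]tauE; exact: interp (tau01 F x xF).
apply: le_trans upper _; apply: le_trans lower; rewrite lerD2l -subr_ge0 -sumrB.
(* The gap between the means of the [k]-th hinge: nonnegative by zonoid inclusion and zero at both
   ends. *)
pose Dl k := mexp F q (hg F k) - mexp G q (hg G k).
have DN : Dl N = 0 by rewrite /Dl !DNE subrr.
have := @abel_ge0 sl Dl N.
rewrite DN mulr0 oppr0 (eq_bigr (fun k : 'I_N =>
  sl k * mexp F q (lay F k) - sl k * mexp G q (lay G k))); last first.
  by move=> k _; rewrite !layE /Dl; ring.
apply.
- move=> k; have := @convexR_increment _ w k%:R k.+1%:R 1 hw _ ler01.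
  by rewrite !natr1; apply; rewrite ler_nat.
- by move=> k; rewrite subr_ge0 !(hgE _ _).2; exact: GF.
- by rewrite /Dl !D0E subrr.
Qed.
End lb_order.

(** * A screening environment with two types *)

Section two_type_environment.
Variables (R : realType) (n : nat) (p1 p2 v u : 'I_n.+1 -> R).
Hypotheses (p1_ge0 : forall i, 0 <= p1 i) (p2_ge0 : forall i, 0 <= p2 i).
Hypotheses (p1_sum1 : \sum_i p1 i = 1) (p2_sum1 : \sum_i p2 i = 1).
Hypothesis p1p2 : p1 <> p2.

Lemma full_restrict (p : 'I_n.+1 -> R) : \sum_i p i = 1 ->
  full (fun i => p (lift ord0 i)) = p.
Proof.
move=> ps; apply/funext => i; rewrite /full; case: unliftP => [j ->//|->].
by rewrite -ps big_ord_recl addrK.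
Qed.

Lemma in_hatDelta_restrict (p : 'I_n.+1 -> R) : (forall i, 0 <= p i) ->
  \sum_i p i = 1 -> in_hatDelta (fun i => p (lift ord0 i)).
Proof.
move=> p0 ps; split=> [i|]; last by rewrite -ps [leRHS]big_ord_recl lerDr.
by rewrite p0 -ps (bigD1 (lift ord0 i))//= lerDl; apply: sumr_ge0.
Qed.

Definition two_types (j : 'I_2) : 'I_n.+1 -> R := if j == ord0 then p1 else p2.

Lemma two_types_sum1 j : \sum_i two_types j i = 1.
Proof. by rewrite /two_types; case: ifP. Qed.

Lemma two_types_ge0 j i : 0 <= two_types j i.
Proof. by rewrite /two_types; case: ifP. Qed.

Definition two_P (j : 'I_2) (i : 'I_n) : R := two_types j (lift ord0 i).

Lemma two_P_inj : injective two_P.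
Proof.
have p12 : (fun i => p1 (lift ord0 i)) <> (fun i => p2 (lift ord0 i)).
  by move=> e; apply: p1p2; rewrite -(full_restrict p1_sum1) e full_restrict.
have two j : j = ord0 \/ j = ord_max :> 'I_2.
  by case: j => [[|[|//]]] h; [left|right]; exact: val_inj.
move=> i j; rewrite /two_P /two_types.
by case: (two i) (two j) => -> [] -> //= e; case: p12; rewrite e.
Qed.

Lemma two_P_in j : in_hatDelta (two_P j).
Proof.
by apply: in_hatDelta_restrict; [exact: two_types_ge0|exact: two_types_sum1].
Qed.

Definition two_prior (i : 'I_n) : R := \sum_(j < 2) 2^-1 * two_P j i.

Lemma two_prior_in : in_hatDelta two_prior.
Proof.
apply: (@in_hatDelta_restrict (fun i => \sum_(j < 2) 2^-1 * two_types j i)) => [i|].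
  by apply: sumr_ge0 => j _; rewrite mulr_ge0 ?two_types_ge0// invr_ge0.
rewrite exchange_big/= (eq_bigr (fun=> 2^-1)); last first.
  by move=> j _; rewrite -mulr_sumr two_types_sum1 mulr1.
by rewrite big_ord_recl big_ord1; lra.
Qed.

(* Alternative 0 is an outside option without information, whose participation
   constraint fixes the transfer to be maximal; alternative 1 reveals the signal. *)
Definition two_type_env : screening_env R n.
Proof.
refine (@ScreeningEnv R n 1 two_prior 2 two_P (fun=> 2^-1)
  (fun a => if a == ord0 then 0 else 1)
  (fun a i => if a == ord0 then 0 else v i) (fun=> 0)
  (fun a i => if a == ord0 then -1 else u i) 0 1
  two_prior_in two_P_in two_P_inj _ _ _ _ _ _ _) => //.
- by rewrite big_ord_recl big_ord1; lra.
- by move=> a; case: ifP; rewrite ?lexx ?ler01.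
- by move=> x; exact: cvg_cst.
- by apply/convexRP => t x y _; rewrite !mulr0 addr0.
Defined.

Lemma cexp_cst (F : experiment R n) (a : R) i : cexp F (fun=> a) i = a.
Proof.
rewrite /cexp RintegralZl ?Rintegral_dens ?mulr1//.
- exact: measurable_sigX.
- exact: integrable_dens.
Qed.

Lemma two_type_agentU (F : experiment R n) (alloc : 'I_2 -> 'I_2 -> R)
    (ts : 'I_2 -> 'I_2 -> R -> R) (tb : 'I_2 -> 'I_2 -> R) (j j' : 'I_2) :
  @agentU R n F two_type_env alloc ts tb j j' =
  alloc j' ord0 * (tb j' ord0 - 1) +
  alloc j' ord_max * \sum_i two_types j i * (u i + cexp F (ts j' ord_max) i).
Proof.
rewrite /agentU big_ord_recl big_ord1/=.
have -> : lift ord0 ord0 = ord_max :> 'I_2 by exact: val_inj.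
rewrite /= subr0 mul1r subrr mul0r addr0 (full_restrict (two_types_sum1 j)).
congr (_ * _ + _ * _).
  under eq_bigr do rewrite mul0r addr0.
  by rewrite -mulr_suml two_types_sum1; ring.
by apply: eq_bigr => i _; rewrite mul1r.
Qed.

Lemma two_type_principalV (F : experiment R n) (alloc : 'I_2 -> 'I_2 -> R)
    (ts : 'I_2 -> 'I_2 -> R -> R) (tb : 'I_2 -> 'I_2 -> R) :
  @principalV R n F two_type_env alloc ts tb =
  2^-1 * (alloc ord0 ord_max * \sum_i p1 i * v i +
          alloc ord_max ord_max * \sum_i p2 i * v i).
Proof.
have l01 : lift ord0 ord0 = ord_max :> 'I_2 by exact: val_inj.
have E j : \sum_(a < 2) alloc j a *
    (\sum_i full (two_P j) i * ((if a == ord0 then 0 else v i) -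
       (if a == ord0 then 0 else 1) * cexp F (fun=> 0) i)
     - (1 - (if a == ord0 then 0 else 1)) * 0) =
    alloc j ord_max * \sum_i two_types j i * v i.
  rewrite big_ord_recl big_ord1 l01/= (full_restrict (two_types_sum1 j)).
  rewrite big1; last by move=> i _; rewrite mul0r subrr mulr0.
  rewrite !mulr0 subrr mulr0 add0r subr0; congr (_ * _).
  by apply: eq_bigr => i _; rewrite cexp_cst mulr0 subr0.
rewrite /principalV/= (eq_bigr (fun j => 2^-1 * (alloc j ord_max * \sum_i two_types j i * v i))).
  by rewrite big_ord_recl big_ord1 l01 -mulrDr.
by move=> j _; congr (_ * _); exact: E.
Qed.

End two_type_environment.

(** * From the welfare comparison to zonoid inclusion *)

Section separation.
Variables (R : realType) (n : nat).
Implicit Types (F G : experiment R n) (c : 'I_n.+1 -> R).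

Lemma test_cst F (a : R) : 0 <= a <= 1 -> test (sigX F) (fun=> a).
Proof. by move=> a01; split; [exact: measurable_cst|]. Qed.

Lemma cexp_test01 F phi i : test (sigX F) phi -> 0 <= cexp F phi i <= 1.
Proof.
move=> tphi; have bphi := test_bounded_meas tphi.
have b (a : R) : bounded_meas F (fun=> a) by split; [exact: measurable_cst|exists `|a|].
rewrite -[X in X <= _ <= _](cexp_cst F 0 i) -[X in _ <= _ <= X](cexp_cst F 1 i).
have [_ phi01] := tphi.
by apply/andP; split; apply: cexp_le => // x xF; have /andP[] := phi01 x xF.
Qed.

(** If [c] violates the inequality by [D], then in the environment built from [c] the experiment [G]
    earns 1/2 by separating the types perfectly, while incentives under [F] cost at least
    [D / (2 * (D + be))]. *)
Lemma W_zonoid_le F G : (forall E, (W G E <= W F E)%E) -> zonoid_le G F.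
Proof.
move=> WGF c; rewrite leNgt; apply/negP; rewrite -subr_gt0.
set D := _ - _ => D0.
pose al := \sum_i Num.max (c i) 0; pose be := \sum_i Num.max (- c i) 0.
have cE i : c i = Num.max (c i) 0 - Num.max (- c i) 0.
  by case: (leP (c i) 0); case: (leP (- c i) 0) => *; lra.
have abE : \sum_i c i = al - be by rewrite -sumrB; apply: eq_bigr => i _; exact: cE.
(* Constant tests bound [supp F c] from below; their extremes 0 and 1 yield [0 < al] and
   [0 < be]. *)
have suppF a : 0 <= a <= 1 -> a * (al - be) <= supp F c.
  move=> a01; have := test_le_support (measurable_sigX F) (integrable_dens F) c (test_cst F a01).
  rewrite -abE mulr_sumr; apply: le_trans; rewrite le_eqVlt; apply/orP; left.
  by apply/eqP/eq_bigr => i _; rewrite [RHS]mulrC; congr (_ * _); rewrite [RHS]cexp_cst.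
have [phi tphi phiE] := support_attained (measurable_sigX G) (integrable_dens G) c.
pose m i := cexp G phi i.
have m01 i : 0 <= m i <= 1 by exact: cexp_test01.
have {}phiE : \sum_i c i * m i = supp G c by exact: phiE.
have suppG : supp G c <= al.
  rewrite -phiE; apply: ler_sum => i _; have /andP[m0 m1] := m01 i.
  by case: (leP (c i) 0) => h; nra.
have al0 : 0 < al by have := suppF 0; rewrite lexx ler01 mul0r; move: D0; rewrite /D; lra.
have be0 : 0 < be by have := suppF 1; rewrite lexx ler01 mul1r; move: D0; rewrite /D; lra.
pose p1 i := Num.max (c i) 0 / al; pose p2 i := Num.max (- c i) 0 / be.
have p1_ge0 i : 0 <= p1 i by rewrite divr_ge0 ?(ltW al0)// le_max lexx orbT.
have p2_ge0 i : 0 <= p2 i by rewrite divr_ge0 ?(ltW be0)// le_max lexx orbT.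
have p1_sum1 : \sum_i p1 i = 1 by rewrite -mulr_suml divff// gt_eqF.
have p2_sum1 : \sum_i p2 i = 1 by rewrite -mulr_suml divff// gt_eqF.
(* [p1] lives where [c] is positive and [p2] where it is negative, so with the sign of [c] as her
   payoff the principal values the monitored alternative at 1 and -1 respectively. *)
have pv1 : \sum_i p1 i * Num.sg (c i) = 1.
  rewrite -p1_sum1; apply: eq_bigr => i _; rewrite /p1.
  by case: (sgrP (c i)) => h; case: (leP (c i) 0) => h'; rewrite ?mul0r ?mulr1//; lra.
have pv2 : \sum_i p2 i * Num.sg (c i) = -1.
  rewrite -p2_sum1 -sumrN; apply: eq_bigr => i _; rewrite /p2.
  by case: (sgrP (c i)) => h; case: (leP (- c i) 0) => h';
    rewrite ?mul0r ?mulrN1 ?oppr0//; lra.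
have p1p2 : p1 <> p2 by move=> e; move: pv1; rewrite e pv2; lra.
have cp i : c i = al * p1 i - be * p2 i.
  by rewrite /p1 /p2 ![_ * (_ / _)]mulrC !divfK ?gt_eqF.
pose E := two_type_env (fun i => Num.sg (c i)) (fun i => - m i)
  p1_ge0 p2_ge0 p1_sum1 p2_sum1 p1p2.
have max2 : (ord_max == ord0 :> 'I_2) = false by [].
have WG : ((2^-1 : R)%:E <= W G E)%E.
  (* Type [p1] gets the monitored alternative with transfer [phi], type [p2] the outside option with
     transfer 1; every report then yields utility 0. *)
  pose alloc (j a : 'I_2) : R := if (a == ord0) == (j == ord0) then 0 else 1.
  pose ts (j a : 'I_2) := phi; pose tb (j a : 'I_2) : R := 1.
  apply: ereal_sup_ubound; exists alloc, ts, tb.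
  have U0 j j' : agentU G (E := E) alloc ts tb j j' = 0.
    rewrite two_type_agentU /tb subrr mulr0 add0r big1 ?mulr0// => i _.
    by rewrite /ts addNr mulr0.
  split; last first.
    rewrite two_type_principalV pv1 pv2 /alloc !max2 !eqxx/=.
    by congr EFin; lra.
  split.
    move=> j; split=> [a|]; first by rewrite /alloc; case: ifP.
    by rewrite big_ord_recl big_ord1 /alloc/=; case: (j == ord0) => /=; lra.
  split; last by split=> [j|j j']; rewrite !U0.
  split; first by move=> j a; case: tphi.
  split; first by move=> j a x xG; case: tphi => _; exact.
  by move=> j a; rewrite /tb/= ler01 lexx.
have WF : (W F E <= (2^-1 - D / (2 * (D + be)))%:E)%E.
  apply: ge_ereal_sup => _ [alloc [ts [tb [[all [[mts [tsM tbM]] [ir ic]]] ->]]]].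
  rewrite two_type_principalV pv1 pv2 lee_fin.
  have al1 j : alloc j ord0 = 1 - alloc j ord_max.
    have [_] := all j; rewrite big_ord_recl big_ord1.
    have -> : lift ord0 ord0 = ord_max :> 'I_2 by exact: val_inj.
    by move=> <-; rewrite addrK.
  have x01 j : 0 <= alloc j ord_max <= 1.
    have [h _] := all j; have := h ord0; have := h ord_max; rewrite al1 => h1 h2.
    by apply/andP; split; lra.
  have tst j a : test (sigX F) (ts j a) by split; [exact: mts|exact: tsM].
  have := ir ord0; have := ic ord_max ord0.
  rewrite !two_type_agentU !al1.
  rewrite /two_types max2 eqxx.
  set A21 := \sum_i p2 i * (_ + cexp F (ts ord0 ord_max) i).
  set A22 := \sum_i p2 i * (_ + cexp F (ts ord_max ord_max) i).
  set A11 := \sum_i p1 i * _.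
  have A22_le1 : A22 <= 1.
    rewrite -p2_sum1; apply: ler_sum => i _; rewrite ler_piMr//.
    have /andP[? ?] := m01 i; have /andP[? ?] := cexp_test01 i (tst ord_max ord_max).
    lra.
  (* The left side is [c] applied to the moments of the transfer minus [m]: under [F], monitoring
     cannot be acceptable to [p1] without being attractive to [p2]. *)
  have key : al * A11 - be * A21 <= - D.
    rewrite !mulr_sumr -sumrB (eq_bigr (fun i =>
      c i * cexp F (ts ord0 ord_max) i - c i * m i)); last first.
      by move=> i _; rewrite cp; ring.
    rewrite sumrB phiE /D opprB lerD2r.
    exact: (test_le_support (measurable_sigX F) (integrable_dens F) c (tst ord0 ord_max)).
  have /andP[t10 t11] := tbM ord0 ord0; have /andP[t20 t21] := tbM ord_max ord0.
  have /andP[x10 x11] := x01 ord0; have /andP[x20 x21] := x01 ord_max.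
  move: t10 t11 t20 t21 x10 x11 x20 x21.
  rewrite [en_mlo _]/= [en_mhi _]/=.
  set x1 := alloc ord0 ord_max; set x2 := alloc ord_max ord_max.
  set t1 := tb ord0 ord0; set t2 := tb ord_max ord0.
  move=> t10 t11 t20 t21 x10 x11 x20 x21 ic21 ir1.
  (* [h1] is (IR) of [p1] and [h2] is (IC) of [p2] against reporting [p1]; payoffs from the outside
     option lie between -1 and 0. *)
  have h1 : 0 <= x1 * A11 by nra.
  have h2 : x1 * A21 <= x2 + (1 - x1) by nra.
  have h3 : x1 * D <= be * (x2 + (1 - x1)).
    have : x1 * (al * A11 - be * A21) <= x1 * - D by rewrite ler_wpM2l.
    have : be * (x1 * A21) <= be * (x2 + (1 - x1)) by rewrite ler_wpM2l// ltW.
    have : 0 <= al * (x1 * A11) by rewrite mulr_ge0// ltW.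
    by lra.
  (* The principal's loss relative to 1/2 is half of [1 - x1 + x2], which is bounded below here. *)
  have h4 : D <= (D + be) * (1 - x1 + x2) by nra.
  have Db : 0 < D + be by rewrite addr_gt0.
  have : D / (D + be) <= 1 - x1 + x2 by rewrite ler_pdivrMr// mulrC.
  have -> : D / (2 * (D + be)) = 2^-1 * (D / (D + be)) by field; rewrite gt_eqF.
  by lra.
have := le_trans WG (le_trans (WGF E) WF); rewrite lee_fin.
have : 0 < D / (2 * (D + be)) by rewrite divr_gt0// mulr_gt0// addr_gt0.
by lra.
Qed.
End separation.

Theorem theorem3 (R : realType) (n : nat) (F G : experiment R n) :
  LB_ge F G <-> (forall E : screening_env R n, (W G E <= W F E)%E).
Proof.
split=> [lb E|WGF]; first exact: zonoid_le_W (LB_ge_zonoid_le lb).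
exact: zonoid_le_LB_ge (W_zonoid_le WGF).
Qed.
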